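(* Let $\kappa$ be an algebraically closed field with $\operatorname{char}(\kappa)\neq 2$. (a) Let $n\geq 1$ and $G=\mathrm{Sp}_{2n}(\kappa)$. If $\mathcal{O}$ is a distinguished nilpotent orbit of $G$ with partition different from $[2n]$, then $\mathcal{O}$ lies below the orbit with partition $[2n]$ in the dominance order, but $\mathcal{O}$ is not accessible from the orbit with partition $[2n]$. In particular, whenever such an orbit exists, the accessibility order on nilpotent orbits of $\mathrm{Sp}_{2n}(\kappa)$ differs from the dominance order. The smallest value of $2n$ for which such an orbit exists is $2n=6$, where the orbit with partition $[4,2]$ is not accessible from the orbit with partition $[6]$ even though $[4,2]<[6]$ in the dominance order. (b) Similarly, let $n\geq 1$ and $G=\mathrm{O}_n(\kappa)$, and let $\mathcal{O}_{\mathrm{top}}$ be the largest nilpotent orbit of $G$ in the dominance order. If $\mathcal{O}\neq\mathcal{O}_{\mathrm{top}}$ is a distinguished nilpotent orbit of $G$, then $\mathcal{O}$ lies below $\mathcal{O}_{\mathrm{top}}$ in the dominance order but is not accessible from $\mathcal{O}_{\mathrm{top}}$; in particular, whenever such an orbit exists, the accessibility order on nilpotent orbits of $\mathrm{O}_n(\kappa)$ differs from the dominance order.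
   Context: $\mathrm{Sp}_{2n}(\kappa)$ and $\mathrm{O}_n(\kappa)$ are the isometry groups of a nondegenerate alternating form on $\kappa^{2n}$, respectively a nondegenerate symmetric bilinear form on $\kappa^n$, acting by conjugation on the nilpotent elements of their Lie algebras. Nilpotent orbits are labelled by the partition of Jordan block sizes: for $\mathrm{Sp}_{2n}(\kappa)$, the partitions of $2n$ in which every odd part has even multiplicity; for $\mathrm{O}_n(\kappa)$, the partitions of $n$ in which every even part has even multiplicity. The largest orbit of $\mathrm{O}_n(\kappa)$ has partition $[n]$ if $n$ is odd and $[n-1,1]$ if $n$ is even. The dominance order on nilpotent orbits is: $\mathcal{O}_2\leq\mathcal{O}_1$ iff $\overline{\mathcal{O}_2}\subseteq\overline{\mathcal{O}_1}$; for these groups it is known to match the dominance order of the labelling partitions ($[a_1\geq a_2\geq\cdots]$ dominates $[b_1\geq b_2\geq\cdots]$ iff $\sum_{i\leq j}a_i\geq\sum_{i\leq j}b_i$ for all $j$). A nilpotent element $y$ (and its orbit) is distinguished if every torus contained in the stabilizer $C_G(y)$ is contained in the center of $G$. Equivalently, the Jordan block sizes are distinct even numbers (symplectic case), respectively distinct odd numbers (orthogonal case). A cocharacter of $G$ is a homomorphism of algebraic groups $\lambda:\mathbb{G}_m\to G$. The limit $\lim_\lambda x=\lim_{a\to0}\lambda(a)\cdot x$ exists if $a\mapsto\lambda(a)\cdot x$ extends to a morphism from $\mathbb{A}^1$; the limit is the image of $0$. An orbit $\mathcal{O}(y)$ is $1$-accessible from $\mathcal{O}(x)$ if there are a cocharacter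 $\lambda$ and an element $x'\in\mathcal{O}(x)$ such that $\lim_\lambda x'$ exists and lies in $\mathcal{O}(y)$. It is accessible from $\mathcal{O}(x)$ if there is a finite chain of orbits from $\mathcal{O}(x)$ to $\mathcal{O}(y)$, each $1$-accessible from the preceding one. Accessibility is a partial order on nilpotent orbits, called the accessibility order. *)

(* Defs.v *)
(* Mathematical Components + multinomials. *)
From Stdlib Require Export Relation_Operators.
From HB Require Export structures.
From mathcomp Require Export all_boot all_order all_algebra.
From mathcomp Require Export mpoly.

Set Implicit Arguments.
Unset Strict Implicit.
Unset Printing Implicit Defensive.

Import GRing.Theory.
#[local] Open Scope ring_scope.

(* A bilinear form on K^n is given by its Gram matrix J, in the row-vector
   convention of mathcomp: (u, v) |-> (u *m J *m v^T) 0 0, matrices acting on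
   row vectors by right multiplication. *)

Definition nondeg_alternating (K : fieldType) n (J : 'M[K]_n) : Prop :=
  J \in unitmx /\ forall u : 'rV[K]_n, u *m J *m u^T = 0.

Definition nondeg_symmetric (K : fieldType) n (J : 'M[K]_n) : Prop :=
  J \in unitmx /\ J^T = J.

(* The isometry group G of J, and its Lie algebra (2 being invertible in K). *)
Definition isom (K : fieldType) n (J g : 'M[K]_n) : Prop :=
  g *m J *m g^T = J.

Definition lie (K : fieldType) n (J x : 'M[K]_n) : Prop :=
  x *m J + J *m x^T = 0.

Definition nilp (K : fieldType) n (J x : 'M[K]_n) : Prop :=
  lie J x /\ exists k : nat, x ^+ k = 0.

Definition orbit (K : fieldType) n (J x y : 'M[K]_n) : Prop :=
  exists2 g, isom J g & y = g *m x *m invmx g.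

(* Zariski closure in the affine space of all n x n matrices; for subsets of G
   or of its Lie algebra, which are closed there, it is also the closure in G,
   resp. in the Lie algebra. *)
Definition mxeval (K : fieldType) n (p : {mpoly K[n * n]}) (x : 'M[K]_n) : K :=
  p.@[fun i => mxvec x 0 i].

Definition zclosure (K : fieldType) n (S : 'M[K]_n -> Prop) (x : 'M[K]_n) :
    Prop :=
  forall p : {mpoly K[n * n]}, (forall y, S y -> mxeval p y = 0) ->
  mxeval p x = 0.

(* Relations between orbits are stated on representatives: [dom_le J y x] means
   that the orbit of y is below the orbit of x. *)
Definition dom_le (K : fieldType) n (J y x : 'M[K]_n) : Prop :=
  forall z, zclosure (orbit J y) z -> zclosure (orbit J x) z.

Definition dom_lt (K : fieldType) n (J y x : 'M[K]_n) : Prop :=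
  dom_le J y x /\ ~ orbit J x y.

Definition largest (K : fieldType) n (J x : 'M[K]_n) : Prop :=
  nilp J x /\ forall z, nilp J z -> dom_le J z x.

(* Nilpotent matrix in Jordan form with consecutive blocks of sizes s_0, s_1,
   ... : row i has its 1 in column i + 1, unless a new block starts there. *)
Definition jordan_mx (K : fieldType) n (s : seq nat) : 'M[K]_n :=
  \matrix_(i, j) ((j == i.+1 :> nat) && (nat_of_ord j \notin scanl addn 0%N s))%:R.

Definition has_partition (K : fieldType) n (x : 'M[K]_n) (s : seq nat) : Prop :=
  [/\ sorted geq s, 0%N \notin s, sumn s = n &
      similar_in unitmx x (jordan_mx K n s)].

(* T is a torus contained in G: a closed subgroup of G isomorphic, as an
   algebraic group, to (K^* )^r.  The coordinates of the isomorphism phi are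
   Laurent polynomials, and those of its inverse are regular functions on T,
   i.e. restrictions of polynomials in the matrix entries since T is closed in
   the affine space of matrices. *)
Definition torus_in (K : fieldType) n (J : 'M[K]_n) (T : 'M[K]_n -> Prop) :
    Prop :=
  (forall g, T g -> isom J g) /\ (forall g, zclosure T g -> T g) /\
  exists (r : nat) (phi : ('I_r -> K) -> 'M[K]_n),
    let Gm a := forall i : 'I_r, a i != 0 :> K in
    [/\ forall g, T g <-> exists2 a, Gm a & g = phi a,
        forall a b, Gm a -> Gm b -> phi (fun i => a i * b i) = phi a *m phi b,
        exists (P : 'M[{mpoly K[r]}]_n) (k : nat), forall a, Gm a ->
          phi a = (\prod_i a i) ^- k *: map_mx (meval a) P &
        exists q : 'I_r -> {mpoly K[n * n]}, forall a, Gm a ->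
          forall i, mxeval (q i) (phi a) = a i].

Definition stabilizer (K : fieldType) n (J y g : 'M[K]_n) : Prop :=
  isom J g /\ g *m y *m invmx g = y.

Definition center (K : fieldType) n (J g : 'M[K]_n) : Prop :=
  isom J g /\ forall h, isom J h -> g *m h = h *m g.

Definition distinguished (K : fieldType) n (J y : 'M[K]_n) : Prop :=
  nilp J y /\
  forall T, torus_in J T -> (forall g, T g -> stabilizer J y g) ->
    forall g, T g -> center J g.

(* Only the values of lam on K^* matter; its entries are Laurent polynomials. *)
Definition cocharacter (K : fieldType) n (J : 'M[K]_n) (lam : K -> 'M[K]_n) :
    Prop :=
  [/\ forall a, a != 0 -> isom J (lam a),
      forall a b, a != 0 -> b != 0 -> lam (a * b) = lam a *m lam b &
      exists (P : 'M[{poly K}]_n) (k : nat), forall a, a != 0 ->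
        lam a = a ^- k *: map_mx (fun p => p.[a]) P].

(* The limit of lam(a) . x as a tends to 0 exists and equals y: Q is the
   extension to the affine line. *)
Definition is_limit (K : fieldType) n (lam : K -> 'M[K]_n) (x y : 'M[K]_n) :
    Prop :=
  exists Q : 'M[{poly K}]_n,
    (forall a, a != 0 ->
       lam a *m x *m invmx (lam a) = map_mx (fun p => p.[a]) Q) /\
    y = map_mx (fun p => p.[0]) Q.

(* [accessible1 J x y], [accessible J x y]: the orbit of y is (1-)accessible
   from the orbit of x.  Limits of nilpotent elements of the Lie algebra are
   again such elements, so a chain starting at one consists of such orbits. *)
Definition accessible1 (K : fieldType) n (J x y : 'M[K]_n) : Prop :=
  exists (lam : K -> 'M[K]_n) (x' y' : 'M[K]_n),
    [/\ cocharacter J lam, orbit J x x', is_limit lam x' y' & orbit J y y'].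

Definition accessible (K : fieldType) n (J : 'M[K]_n) :
    'M[K]_n -> 'M[K]_n -> Prop :=
  clos_refl_trans 'M[K]_n (accessible1 J).

Definition orders_differ (K : fieldType) n (J : 'M[K]_n) : Prop :=
  ~ forall x y, nilp J x -> nilp J y -> (accessible J x y <-> dom_le J y x).

(* Main.v *)
(** A torus in the stabilizer of [y] gives, through the weight spaces of a
    cocharacter, an idempotent [P] commuting with [y] whose adjoint [Q] with
    respect to [J] satisfies [P Q = Q P = 0]; conversely such a pair spans the
    torus [a P + a^-1 Q + (1 - P - Q)], which is not central unless [P = 0].
    If [y] is the limit of [x] along a cocharacter, this cocharacter fixes [y];
    when [y] is distinguished its nontrivial weights vanish, so [y = x].  Hence
    a distinguished orbit is accessible from no orbit but itself.

    For the dominance order: every nilpotent [z] lies on a line [z + t w] in the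
    Lie algebra consisting of nilpotent elements, all but finitely many of which
    are regular, and the regular nilpotent elements form one orbit.  Hence every
    nilpotent element is in the closure of the regular orbit.  In dimension [n]
    regular means [x ^+ d != 0], where [d] is the largest integer below [n] such
    that [(-1) ^+ d] is the sign of the form. *)
Require Import Defs.
From Stdlib Require Import Operators_Properties.
From mathcomp Require Import zify ring.
Set Implicit Arguments.
Unset Strict Implicit.
Unset Printing Implicit Defensive.
Import GRing.Theory.
#[local] Open Scope ring_scope.

(** * Polynomials over an algebraically closed field *)

(** Tori enter only through [pair_free], a condition on matrices that is equivalent to being
    distinguished for nilpotent elements. The line through [z] is built by induction in steps of
    two: an isotropic [v] killed by [z] leaves a form of the same sign on v^perp / v, and a regular
    direction found there lifts back, raising both the dimension and [d] by 2. The sign (-1)^d makes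
    [w ^+ d *m J] symmetric, so that it takes a nonzero value on some vector; for a symmetric form
    in even dimension n the exponent n - 1 has the wrong parity, whence [n-1,1]. Regular elements
    form one orbit because they have a cyclic vector, or one up to a line, whose chain has a fixed
    Gram matrix. The bound 6 comes from explicit pairs for all non-regular nilpotent elements of
    symplectic spaces of dimension 2 and 4. *)

Lemma two_neq0 (K : closedFieldType) (charK : 2%N \notin [pchar K]) :
  2%:R != 0 :> K.
Proof. by move: charK; rewrite !inE. Qed.

Lemma closed_sqrt (K : closedFieldType) (a : K) : exists s, s ^+ 2 = a.
Proof.
have /closed_rootP [s] : size ('X^2 - a%:P) != 1%N by rewrite size_XnsubC.
by rewrite rootE !hornerE subr_eq0 => /eqP; exists s.
Qed.

Lemma poly_neq0_nonroot (K : closedFieldType) (p : {poly K}) :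
  p != 0 -> exists a, p.[a] != 0.
Proof.
move=> p0; have [p1|p1] := eqVneq (size p) 1%N.
  have /size_poly1P [c c0 ->] := introT eqP p1.
  by exists 0; rewrite hornerC.
(* At a root of [p + 1] the value of [p] is -1. *)
have /closed_rootP [a] : size (p + 1) != 1%N.
  rewrite size_polyDl // size_poly1.
  by move: p1 p0; rewrite -size_poly_eq0; case: size => [|[]].
rewrite rootE hornerD hornerC addr_eq0 => /eqP pa.
by exists a; rewrite pa oppr_eq0 oner_neq0.
Qed.

Lemma eq_poly_off_roots (K : closedFieldType) (r p q : {poly K}) :
  r != 0 -> (forall a, r.[a] != 0 -> p.[a] = q.[a]) -> p = q.
Proof.
move=> r0 pq; apply/eqP; rewrite -subr_eq0; apply/negPn/negP => d0.
have [a] := poly_neq0_nonroot (mulf_neq0 r0 d0).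
rewrite hornerM mulf_eq0 negb_or hornerD hornerN => /andP[ra].
by rewrite pq // subrr eqxx.
Qed.

Lemma eq_poly_off0 (K : closedFieldType) (p q : {poly K}) :
  (forall a, a != 0 -> p.[a] = q.[a]) -> p = q.
Proof.
move=> pq; apply: (@eq_poly_off_roots _ 'X); first by rewrite polyX_eq0.
by move=> a; rewrite hornerX => /pq.
Qed.

Lemma exists_expr_neq (K : closedFieldType) (i j : nat) :
  i != j -> exists2 a : K, a != 0 & a ^+ i != a ^+ j.
Proof.
move=> ij; have : 'X * ('X^i - 'X^j) != 0 :> {poly K}.
  rewrite mulf_neq0 ?polyX_eq0 // subr_eq0; apply: contra_neq ij =>
    /(congr1 (fun p : {poly K} => size p)).
  by rewrite !size_polyXn => -[].
case/poly_neq0_nonroot => a; rewrite !hornerE mulf_eq0 negb_or subr_eq0.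
by case/andP; exists a.
Qed.

(** Each entry is a polynomial in [a] known off 0, so its coefficients are determined; this
    separates the weights of cocharacters below. *)
Lemma eq_pow_sum (K : closedFieldType) n M (A B : 'I_M -> 'M[K]_n) :
  (forall a, a != 0 -> \sum_(i < M) a ^+ i *: A i = \sum_(i < M) a ^+ i *: B i) ->
  forall i, A i = B i.
Proof.
move=> AB i; apply/matrixP => u v.
pose p (C : 'I_M -> 'M[K]_n) := \sum_(i < M) C i u v *: 'X^i : {poly K}.
have pE C a : (p C).[a] = (\sum_(i < M) a ^+ i *: C i) u v.
  rewrite /p horner_sum summxE; apply: eq_bigr => j _.
  by rewrite !hornerE mxE mulrC.
have pC C : (p C)`_i = C i u v.
  rewrite coef_sum (bigD1 i) //= coefZ coefXn eqxx mulr1 big1 ?addr0 // => j ji.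
  by rewrite coefZ coefXn (negbTE (_ : i != j :> nat)) ?mulr0 // eq_sym.
by rewrite -!pC (@eq_poly_off0 _ (p A) (p B)) // => a a0; rewrite !pE AB.
Qed.

Lemma meval_horner (K : comNzRingType) n (f : 'I_n -> {poly K}) (p : {mpoly K[n]}) :
  exists q : {poly K}, forall t, q.[t] = p.@[fun i => (f i).[t]].
Proof.
elim/mpolyind: p => [|c m p _ _ [q qE]].
  by exists 0 => t; rewrite horner0 meval0.
exists (c *: (\prod_i f i ^+ m i) + q) => t.
rewrite !hornerE qE mevalD mevalZ mevalX horner_prod; congr (_ * _ + _).
by apply: eq_bigr => i _; rewrite horner_exp.
Qed.

Definition generic_mx (K : fieldType) n : 'M[{mpoly K[n * n]}]_n :=
  \matrix_(i, j) 'X_(mxvec_index i j).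

Definition mxeval_mx (K : fieldType) n m1 m2 (F : 'M[{mpoly K[n * n]}]_(m1, m2))
  (x : 'M[K]_n) : 'M[K]_(m1, m2) := map_mx (meval (fun i => mxvec x 0 i)) F.

Lemma mxevalE (K : fieldType) n (x : 'M[K]_n) : mxeval_mx (generic_mx K n) x = x.
Proof. by apply/matrixP => i j; rewrite !mxE mevalXU mxvecE. Qed.

Lemma mxeval_map (K : fieldType) n m1 m2 (A : 'M[K]_(m1, m2)) (x : 'M[K]_n) :
  mxeval_mx (map_mx (@mpolyC (n * n) K) A) x = A.
Proof. by apply/matrixP => i j; rewrite !mxE mevalC. Qed.

Lemma mxevalM (K : fieldType) n m1 m2 m3 (F : 'M[{mpoly K[n * n]}]_(m1, m2))
   (G : 'M_(m2, m3)) (x : 'M[K]_n) :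
  mxeval_mx (F *m G) x = mxeval_mx F x *m mxeval_mx G x.
Proof. exact: map_mxM. Qed.

Lemma mxevalX (K : fieldType) n (x : 'M[K]_n) k :
  mxeval_mx (generic_mx K n ^+ k) x = x ^+ k.
Proof.
elim: k => [|k IH]; first by rewrite !expr0; apply/matrixP => i j; rewrite !mxE rmorph_nat.
by rewrite !exprS -!mulmxE mxevalM IH mxevalE.
Qed.

Lemma zclosure_mx (K : fieldType) n (S : 'M[K]_n -> Prop) m1 m2
    (F : 'M[{mpoly K[n * n]}]_(m1, m2)) x :
  zclosure S x -> (forall y, S y -> mxeval_mx F y = 0) -> mxeval_mx F x = 0.
Proof.
move=> Sx SF; apply/matrixP => i j; rewrite !mxE.
by apply: Sx => y /SF /matrixP /(_ i j); rewrite !mxE.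
Qed.

(** * Bilinear forms and nilpotent matrices *)

Definition form (K : fieldType) n (S : 'M[K]_n) (u v : 'rV[K]_n) : K :=
  (u *m S *m v^T) 0 0.

Lemma formE (K : fieldType) n (S : 'M[K]_n) (u v : 'rV[K]_n) :
  u *m S *m v^T = (form S u v)%:M.
Proof. exact: mx11_scalar. Qed.

Lemma formDl (K : fieldType) n (S : 'M[K]_n) (u v w : 'rV[K]_n) :
  form S (u + v) w = form S u w + form S v w.
Proof. by rewrite /form !mulmxDl mxE. Qed.

Lemma formDr (K : fieldType) n (S : 'M[K]_n) (u v w : 'rV[K]_n) :
  form S w (u + v) = form S w u + form S w v.
Proof. by rewrite /form linearD mulmxDr mxE. Qed.

Lemma formZl (K : fieldType) n (S : 'M[K]_n) c (u v : 'rV[K]_n) :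
  form S (c *: u) v = c * form S u v.
Proof. by rewrite /form -!scalemxAl mxE. Qed.

Lemma formZr (K : fieldType) n (S : 'M[K]_n) c (u v : 'rV[K]_n) :
  form S u (c *: v) = c * form S u v.
Proof. by rewrite /form linearZ -scalemxAr mxE. Qed.

Lemma formNr (K : fieldType) n (S : 'M[K]_n) (u v : 'rV[K]_n) :
  form S u (- v) = - form S u v.
Proof. by rewrite -scaleN1r formZr mulN1r. Qed.

Lemma formNl (K : fieldType) n (S : 'M[K]_n) (u v : 'rV[K]_n) :
  form S (- u) v = - form S u v.
Proof. by rewrite -scaleN1r formZl mulN1r. Qed.

Lemma form_tr (K : fieldType) n (S : 'M[K]_n) (u v : 'rV[K]_n) :
  form S^T u v = form S v u.
Proof. by rewrite /form -[v *m S *m u^T]trmxK [RHS]mxE !trmx_mul trmxK mulmxA. Qed.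

Lemma formZm (K : fieldType) n c (S : 'M[K]_n) (u v : 'rV[K]_n) :
  form (c *: S) u v = c * form S u v.
Proof. by rewrite /form -scalemxAr -scalemxAl mxE. Qed.

Lemma formBm (K : fieldType) n (S T : 'M[K]_n) (u v : 'rV[K]_n) :
  form (S - T) u v = form S u v - form T u v.
Proof. by rewrite /form mulmxBr mulmxBl !mxE. Qed.

Definition formB := (formDl, formDr, formZl, formZr, formNl, formNr).

Lemma form_nondeg (K : fieldType) n (S : 'M[K]_n) (u : 'rV[K]_n) :
  (forall v, form S u v = 0) -> u *m S = 0.
Proof.
move=> S0; apply/rowP => j; have := S0 (delta_mx 0 j).
by rewrite /form trmx_delta -colE !mxE.
Qed.

Lemma form_eq0 (K : fieldType) n (S : 'M[K]_n) :
  (forall u v, form S u v = 0) -> S = 0.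
Proof.
by move=> S0; apply/row_matrixP => i; rewrite rowE form_nondeg ?row0.
Qed.

(** If the quadratic form vanished on all sums of two basis vectors, polarisation would make [S]
    zero; a nonzero value is scaled to 1 by a square root. *)
Lemma symmetric_unit_vector (K : closedFieldType) n (S : 'M[K]_n) :
  2%:R != 0 :> K -> S^T = S -> S != 0 -> exists u, form S u u = 1.
Proof.
move=> two0 Ssym S0.
have [u Su] : exists u, form S u u != 0.
  pose w i j : 'rV[K]_n := delta_mx 0 i + delta_mx 0 j.
  case: (boolP [forall i, [forall j, form S (w i j) (w i j) == 0]]).
    move=> /forallP H; case/eqP: S0; apply/matrixP => i j.
    have dE k l : form S (delta_mx 0 k) (delta_mx 0 l) = S k l.
      by rewrite /form trmx_delta -rowE -colE !mxE.
    have d0 k : S k k = 0.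
      have := forallP (H k) k => /eqP; rewrite !formB !dE => e0.
      have : 2%:R * 2%:R * S k k = 0 by rewrite -{}[RHS]e0; ring.
      by move/eqP; rewrite !mulf_eq0 (negbTE two0) => /eqP.
    have := forallP (H i) j => /eqP; rewrite !formB !dE !d0 add0r addr0.
    have -> : S j i = S i j by rewrite -[in LHS]Ssym mxE.
    rewrite mxE => e0; apply/eqP; rewrite -[_ == 0]orFb -(negbTE two0) -mulf_eq0.
    by rewrite mulr_natl mulr2n e0.
  by rewrite negb_forall => /existsP[i]; rewrite negb_forall => /existsP[j]; eexists; eassumption.
have [s sE] := closed_sqrt (form S u u)^-1.
exists (s *: u); rewrite formZl formZr mulrA -expr2 sE mulVf //.
Qed.

Lemma symmetric_hyperbolic (K : closedFieldType) n (S : 'M[K]_n) :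
  2%:R != 0 :> K -> S^T = S -> (1 < \rank S)%N ->
  exists e f, [/\ form S e e = 0, form S f f = 0 & form S e f = 1].
Proof.
move=> two0 Ssym rS.
have SC u v : form S u v = form S v u by rewrite -{1}Ssym form_tr.
have [|a aa] := symmetric_unit_vector two0 Ssym.
  by apply: contraTneq rS => ->; rewrite mxrank0.
(* The form [S] with its part along [a] removed: [a] lies in the radical of [S'], and a rank one
   correction cannot kill [S]. *)
pose S' := S - S *m a^T *m (a *m S).
have S'E u v : form S' u v = form S u v - form S u a * form S a v.
  rewrite formBm; congr (_ - _).
  by rewrite {1}/form !mulmxA (formE S u a) mul_scalar_mx -!scalemxAl mxE.
have [||u uu] := @symmetric_unit_vector _ _ S' two0.
- by rewrite /S' linearB /= !trmx_mul trmxK Ssym !mulmxA.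
- rewrite subr_eq0; apply: contraTneq rS => ->.
  by rewrite -leqNgt (leq_trans (mxrankM_maxr _ _)) // rank_leq_row.
have [c c2] := closed_sqrt (-1 : K).
(* The component of [u] orthogonal to [a], scaled to value -1, so that [a + b] and [a - b] are
   isotropic. *)
pose b := c *: (u - form S u a *: a).
have ab : form S a b = 0 by rewrite /b !formB aa (SC u a); ring.
have ba : form S b a = 0 by rewrite SC.
have bb : form S b b = -1.
  have /eqP := uu; rewrite S'E (SC a u) subr_eq => /eqP uuE.
  rewrite -c2 /b !formB aa (SC a u) uuE; ring.
clearbody b.
exists (a + b), (2%:R^-1 *: (a - b)); rewrite !formB aa ab ba bb; split; try by field.
Qed.

Lemma lie_exp_tr (K : fieldType) n (J x : 'M[K]_n) k :
  lie J x -> J *m (x ^+ k)^T = (-1) ^+ k *: (x ^+ k *m J).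
Proof.
move/eqP; rewrite addrC addr_eq0 => /eqP xJ.
elim: k => [|k IH]; first by rewrite !expr0 trmx1 mulmx1 mul1mx scale1r.
rewrite {1}exprSr -mulmxE trmx_mul mulmxA xJ mulNmx -(mulmxA x J) IH -scalemxAr.
by rewrite mulmxA mulmxE -exprS (exprS (-1)) mulN1r scaleNr.
Qed.

(** Equal ranks would put [A] inside [A *m y], hence by iteration inside [A *m y ^+ k], which is
    zero. *)
Lemma nilp_rank_lt (K : fieldType) n m (y : 'M[K]_n) (A : 'M[K]_(m, n)) k :
  y ^+ k = 0 -> (A *m y <= A)%MS -> A != 0 -> (\rank (A *m y) < \rank A)%N.
Proof.
move=> yk AyA A0; rewrite ltn_neqAle mxrankS // andbT.
apply: contra A0 => /eqP rA.
have AA : (A <= A *m y)%MS by rewrite -(geq_leqif (mxrank_leqif_sup AyA)) rA.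
suff: (A <= A *m y ^+ k)%MS by rewrite yk mulmx0 => /submx0null->.
elim: k {yk} => [|k IH]; first by rewrite expr0 mulmx1.
by rewrite exprSr -mulmxE mulmxA (submx_trans AA) ?submxMr.
Qed.

Lemma nilp_exp_rank (K : fieldType) n (y : 'M[K]_n) k i :
  y ^+ k = 0 -> (\rank (y ^+ i) <= n - i)%N.
Proof.
move=> yk; elim: i => [|i IH]; first by rewrite subn0 rank_leq_row.
have [y0|y0] := eqVneq (y ^+ i) 0; first by rewrite exprS y0 mulr0 mxrank0.
rewrite subnS -ltnS (leq_trans _ (leqSpred _)) //.
apply: leq_trans IH; rewrite exprSr; apply: nilp_rank_lt yk _ y0.
by rewrite mulmxE -exprSr exprS -mulmxE submxMl.
Qed.

Lemma nilp_exp_dim (K : fieldType) n (y : 'M[K]_n) k : y ^+ k = 0 -> y ^+ n = 0.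
Proof.
move=> /(@nilp_exp_rank _ _ _ _ n); rewrite subnn leqn0 mxrank_eq0.
by move/eqP.
Qed.

Lemma alternating_tr (K : fieldType) n (J : 'M[K]_n) :
  (forall u : 'rV[K]_n, u *m J *m u^T = 0) -> J^T = - J.
Proof.
move=> J0; have f0 u : form J u u = 0 by rewrite /form J0 mxE.
apply/eqP; rewrite -subr_eq0; apply/eqP; apply: form_eq0 => u v.
rewrite formBm form_tr -scaleN1r formZm mulN1r opprK.
by have := f0 (u + v); rewrite !formB !f0 add0r addr0 addrC.
Qed.

Lemma alternating_form (K : fieldType) n (J : 'M[K]_n) (u : 'rV[K]_n) :
  2%:R != 0 :> K -> J^T = - J -> form J u u = 0.
Proof.
move=> two0 JT; have := form_tr J u u; rewrite JT -scaleN1r formZm mulN1r.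
move/eqP; rewrite eq_sym -addr_eq0 -mulr2n -mulr_natl mulf_eq0 (negbTE two0).
by move/eqP.
Qed.

Lemma scalemx_exp (K : fieldType) n c (x : 'M[K]_n) k : (c *: x) ^+ k = c ^+ k *: x ^+ k.
Proof.
elim: k => [|k IH]; first by rewrite !expr0 scale1r.
by rewrite !exprS IH -!mulmxE -scalemxAl -scalemxAr scalerA.
Qed.

Lemma lie_J_tr (K : fieldType) n (J y : 'M[K]_n) : lie J y -> J *m y^T = - (y *m J).
Proof. by move=> ly; apply/eqP; rewrite -addr_eq0 addrC ly. Qed.

(** * Adjoint pairs of idempotents and tori *)

Lemma isom_unit (K : fieldType) n (J g : 'M[K]_n) :
  J \in unitmx -> isom J g -> g \in unitmx.
Proof.
move=> uJ gJ; have [] // := @mulmx1_unit _ _ g (J *m g^T *m invmx J).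
by rewrite !mulmxA gJ mulmxV.
Qed.

Lemma isomM (K : fieldType) n (J g h : 'M[K]_n) :
  isom J g -> isom J h -> isom J (g *m h).
Proof. by rewrite /isom trmx_mul => gJ hJ; rewrite !mulmxA -2!(mulmxA g) hJ. Qed.

Lemma isomV (K : fieldType) n (J g : 'M[K]_n) :
  J \in unitmx -> isom J g -> isom J (invmx g).
Proof.
move=> uJ gJ; have ug := isom_unit uJ gJ.
by rewrite /isom -[in LHS]gJ !mulmxA mulVmx // mul1mx -mulmxA -trmx_mul mulVmx // trmx1 mulmx1.
Qed.

Lemma orbit_refl (K : fieldType) n (J x : 'M[K]_n) : orbit J x x.
Proof.
exists 1%:M; first by rewrite /isom mul1mx trmx1 mulmx1.
by rewrite mul1mx invmx1 mulmx1.
Qed.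

Lemma orbit_sym (K : fieldType) n (J x y : 'M[K]_n) :
  J \in unitmx -> orbit J x y -> orbit J y x.
Proof.
move=> uJ [g gJ ->]; have ug := isom_unit uJ gJ.
exists (invmx g); first exact: isomV.
by rewrite invmxK !mulmxA mulVmx // mul1mx mulmxKV.
Qed.

Lemma invmxM (K : fieldType) n (g h : 'M[K]_n) :
  g \in unitmx -> h \in unitmx -> invmx (g *m h) = invmx h *m invmx g.
Proof.
move=> ug uh; apply: (can_inj (mulKmx (_ : g *m h \in unitmx))).
  by rewrite unitmx_mul ug.
by rewrite mulmxV ?unitmx_mul ?ug // !mulmxA mulmxK // mulmxV.
Qed.

Lemma orbit_trans (K : fieldType) n (J x y z : 'M[K]_n) :
  J \in unitmx -> orbit J x y -> orbit J y z -> orbit J x z.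
Proof.
move=> uJ [g gJ ->] [h hJ ->]; exists (h *m g); first exact: isomM.
by rewrite invmxM ?(isom_unit uJ) // !mulmxA.
Qed.

Lemma conj_exp (K : fieldType) n (g x : 'M[K]_n) k : g \in unitmx ->
  (g *m x *m invmx g) ^+ k = g *m x ^+ k *m invmx g.
Proof.
move=> ug; elim: k => [|k IH]; first by rewrite !expr0 mulmx1 mulmxV.
by rewrite !exprSr -!mulmxE IH !mulmxA mulmxKV.
Qed.

Lemma conj_eq0 (K : fieldType) n (g x : 'M[K]_n) : g \in unitmx ->
  (g *m x *m invmx g == 0) = (x == 0).
Proof.
move=> ug; apply/eqP/eqP => [|->]; last by rewrite mulmx0 mul0mx.
move/(congr1 (fun y => invmx g *m y *m g)).
by rewrite mulmx0 mul0mx !mulmxA mulVmx // mul1mx mulmxKV.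
Qed.

Lemma lie_conj (K : fieldType) n (J g x : 'M[K]_n) : g \in unitmx ->
  lie J x -> lie (g *m J *m g^T) (g *m x *m invmx g).
Proof.
move=> ug; rewrite /lie => xJ.
rewrite !mulmxA mulmxKV // !trmx_mul !mulmxA.
rewrite -(mulmxA (g *m J)) -trmx_mul mulVmx // trmx1 mulmx1.
by rewrite -mulmxDl -!mulmxA -mulmxDr xJ mulmx0 mul0mx.
Qed.

Lemma orbit_nilp (K : fieldType) n (J x y : 'M[K]_n) :
  J \in unitmx -> nilp J x -> orbit J x y -> nilp J y.
Proof.
move=> uJ [lx [k xk]] [g gJ ->]; have ug := isom_unit uJ gJ.
split; first by rewrite -{1}gJ; apply: lie_conj.
by exists k; rewrite conj_exp // xk mulmx0 mul0mx.
Qed.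

(** [P] and [Q] are to be the projections onto the weight spaces 1 and -1 of a one-dimensional
    torus. The last equation says that [Q] is the adjoint of [P]; together with [P *m Q = 0] it
    makes the image of [P] totally isotropic. *)
Definition adjoint_pair (K : fieldType) n (J P Q : 'M[K]_n) :=
  [/\ P *m P = P, P *m Q = 0, Q *m P = 0 & P *m J = J *m Q^T].

Lemma adjoint_pair_sym (K : fieldType) n (J P Q : 'M[K]_n) d :
  J \in unitmx -> J^T = (-1) ^+ d *: J -> adjoint_pair J P Q ->
  adjoint_pair J Q P.
Proof.
move=> uJ JT [PP PQ QP PJ]; split => //.
  apply: trmx_inj; apply: (can_inj (mulKmx uJ)).
  by rewrite trmx_mul mulmxA -!PJ -mulmxA -PJ mulmxA PP.
have /(congr1 trmx) := PJ; rewrite !trmx_mul trmxK JT -scalemxAl -scalemxAr.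
by move/(scalerI (_ : (-1) ^+ d != 0)) => ->; rewrite ?signr_eq0.
Qed.

Lemma adjoint_pair_commute (K : fieldType) n (J P Q y : 'M[K]_n) :
  J \in unitmx -> lie J y -> P *m J = J *m Q^T ->
  P *m y = y *m P -> Q *m y = y *m Q.
Proof.
move=> uJ /eqP; rewrite addr_eq0 => /eqP yJ PJ Py.
have Jy : J *m y^T = - (y *m J) by rewrite yJ opprK.
apply: trmx_inj; apply: (can_inj (mulKmx uJ)).
rewrite !trmx_mul !mulmxA -PJ Jy -[P *m J *m _]mulmxA Jy mulNmx mulmxN.
by rewrite -mulmxA -PJ !mulmxA Py.
Qed.

Definition pair_torus (K : fieldType) n (P Q : 'M[K]_n) (a : K) :=
  a *: P + a^-1 *: Q + (1%:M - P - Q).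

Lemma pair_torusM (K : fieldType) n (P Q : 'M[K]_n) (a b : K) :
  P *m P = P -> Q *m Q = Q -> P *m Q = 0 -> Q *m P = 0 ->
  pair_torus P Q (a * b) = pair_torus P Q a *m pair_torus P Q b.
Proof.
move=> PP QQ PQ QP; rewrite /pair_torus; set R := 1%:M - P - Q.
have PR : P *m R = 0 by rewrite /R !mulmxBr PP PQ mulmx1 subrr subr0.
have QR : Q *m R = 0 by rewrite /R !mulmxBr QQ QP mulmx1 subr0 subrr.
have RP : R *m P = 0 by rewrite /R !mulmxBl PP QP mul1mx subrr subr0.
have RQ : R *m Q = 0 by rewrite /R !mulmxBl QQ PQ mul1mx subr0 subrr.
have RR : R *m R = R by rewrite {2}/R !mulmxBr RP RQ mulmx1 !subr0.
clearbody R; rewrite !mulmxDl !mulmxDr -!scalemxAl -!scalemxAr PP PQ PR QP QQ QR RP RQ RR.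
by rewrite !scaler0 !scalerA !(add0r, addr0) invfM.
Qed.

Lemma pair_torus1 (K : fieldType) n (P Q : 'M[K]_n) : pair_torus P Q 1 = 1%:M.
Proof. by rewrite /pair_torus invr1 !scale1r -[_ - P - Q]addrA -opprD addrCA subrr addr0. Qed.

Lemma pair_torus_isom (K : fieldType) n (J P Q : 'M[K]_n) d a :
  J \in unitmx -> J^T = (-1) ^+ d *: J -> adjoint_pair J P Q -> a != 0 ->
  isom J (pair_torus P Q a).
Proof.
move=> uJ JT PQp a0.
have [QQ _ _ QJ] := adjoint_pair_sym uJ JT PQp.
case: PQp => PP PQ QP PJ.
have JT' : J *m (pair_torus P Q a)^T = pair_torus P Q a^-1 *m J.
  rewrite /pair_torus !linearD !linearN !linearZ /= trmx1 invrK.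
  rewrite ?mulmxDl ?mulmxDr ?mulmxN ?mulNmx -?scalemxAl -?scalemxAr -PJ -QJ mulmx1 mul1mx.
  by rewrite [X in X + _]addrC -!addrA; congr (_ + (_ + (_ + _))); rewrite addrC.
by rewrite /isom -mulmxA JT' mulmxA -pair_torusM // mulfV // pair_torus1 mul1mx.
Qed.

(** A central element commutes with an isometry that mixes the two weight spaces, so its eigenvalues
    there agree. The value [a = -1] cannot be excluded: it gives the scalar -1 when
    [P + Q = 1%:M]. *)
Lemma pair_torus_noncentral (K : fieldType) n (J P Q : 'M[K]_n) d a :
  2%:R != 0 :> K ->
  J \in unitmx -> J^T = (-1) ^+ d *: J -> adjoint_pair J P Q -> P != 0 ->
  a != 0 -> center J (pair_torus P Q a) -> a = a^-1.
Proof.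
move=> two0 uJ JT PQp P0 a0 [_ cen].
have [QQ _ _ QJ] := adjoint_pair_sym uJ JT PQp.
case: PQp => PP PQ QP PJ.
(* This matrix equals [P *m J]; a nonzero entry is a row of [P] pairing nontrivially with a row of
   [Q]. *)
have : P *m J *m Q^T != 0.
  rewrite -mulmxA -PJ mulmxA PP.
  by apply: contraNneq P0 => PJ0; rewrite -(mulmxK uJ P) PJ0 mul0mx.
case/matrix0Pn => i [j ij].
pose p := row i P; pose q := row j Q.
have pq0 : form J p q != 0.
  suff -> : form J p q = (P *m J *m Q^T) i j by [].
  by rewrite /form -row_mul mxE [RHS]mxE; apply: eq_bigr => k _; rewrite !mxE.
have pP : p *m P = p by rewrite /p -row_mul PP.
have pQ : p *m Q = 0 by rewrite /p -row_mul PQ row0.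
have qQ : q *m Q = q by rewrite /q -row_mul QQ.
have qP : q *m P = 0 by rewrite /q -row_mul QP row0.
have pp : form J p p = 0.
  by rewrite /form -{1}pP -(mulmxA p) PJ -!mulmxA -trmx_mul pQ trmx0 !mulmx0 mxE.
have qq : form J q q = 0.
  by rewrite /form -{1}qQ -(mulmxA q) QJ -!mulmxA -trmx_mul qP trmx0 !mulmx0 mxE.
have qp : form J q p = (-1) ^+ d * form J p q by rewrite -form_tr JT formZm.
(* The vector v is not an eigenvector of the torus, so the transvection
   (alternating case) or reflection (symmetric case) along v does not commute
   with it. *)
pose v := p + q.
have vv : form J v v = (1 + (-1) ^+ d) * form J p q.
  by rewrite /v !formB pp qq qp; ring.
(* The condition for 1 + c J v^T v to be an isometry. In the alternating case [v] is isotropic and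
   any [c] works; in the symmetric case [c] is the reflection coefficient. *)
have [c c0 cE] : exists2 c, c != 0 & 1 + (-1) ^+ d + c * (-1) ^+ d * form J v v = 0.
  move: vv; rewrite -signr_odd; case: (odd d) => vv.
    by exists 1; rewrite ?oner_neq0 // vv expr1 subrr mul0r mulr0 addr0.
  exists (- 2%:R / form J v v).
    rewrite mulf_neq0 ?oppr_eq0 // invr_eq0 vv expr0.
    by rewrite mulf_neq0.
  by rewrite expr0 mulr1 mulfVK ?vv ?mulf_neq0 //; ring.
have [A AE] : exists A, A = v^T *m v by eexists.
have AT : A^T = A by rewrite AE trmx_mul trmxK.
pose h := 1%:M + c *: (J *m A).
have AJA : A *m J *m A = form J v v *: A.
  by rewrite AE !mulmxA -2!(mulmxA v^T) formE mul_mx_scalar -scalemxAl.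
have hT : h^T = 1%:M + (c * (-1) ^+ d) *: (A *m J).
  by rewrite /h linearD linearZ /= trmx1 trmx_mul AT JT -scalemxAr scalerA.
have hJ : isom J h.
  rewrite /isom hT /h mulmxDl mul1mx mulmxDr mulmx1 mulmxDl.
  rewrite -?scalemxAl -?scalemxAr -?scalemxAl !scalerA.
  rewrite -addrA -[RHS]addr0; congr (_ + _).
  rewrite !mulmxA -2!(mulmxA J) AJA -scalemxAr -scalemxAl scalerA !mulmxA -!scalerDl.
  rewrite (_ : _ + _ = c * (1 + (-1) ^+ d + c * (-1) ^+ d * form J v v)).
    by rewrite cE mulr0 scale0r.
  by ring.
have pmu : p *m pair_torus P Q a = a *: p.
  rewrite /pair_torus !mulmxDr !mulmxN -!scalemxAr pP pQ mulmx1 scaler0 oppr0.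
  by rewrite !addr0 subrr addr0.
have vmu : v *m pair_torus P Q a = a *: p + a^-1 *: q.
  rewrite mulmxDl pmu; congr (_ + _).
  rewrite /pair_torus !mulmxDr !mulmxN -!scalemxAr qP qQ mulmx1 scaler0 oppr0.
  by rewrite !addr0 add0r subrr addr0.
move: (pair_torus P Q a) cen pmu vmu => mu cen pmu vmu.
(* Applied to [p], commutation makes [v = p + q] an eigenvector for the eigenvalue [a], whereas [q]
   has eigenvalue [a^-1]. *)
have := cen h hJ; rewrite /h mulmxDr mulmxDl mul1mx mulmx1 => /addrI.
rewrite -scalemxAl -scalemxAr => /(scalerI c0) /(congr1 (mulmx p)).
have pJv : p *m J *m v^T = (form J p q)%:M by rewrite formE /v formDr pp add0r.
rewrite AE !mulmxA pmu -!scalemxAl pJv -!mulmxA vmu !mul_scalar_mx scalerA mulrC.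
rewrite -scalerA => /(scalerI pq0)/eqP; rewrite /v scalerDr (inj_eq (addrI _)).
rewrite -subr_eq0 -scalerBl scaler_eq0 subr_eq0 => /orP[/eqP //|/eqP q0].
by move: pq0; rewrite q0 /form trmx0 mulmx0 mxE eqxx.
Qed.

Lemma entry_scaled_idempotent (K : fieldType) n (P M : 'M[K]_n) i j c :
  P i j != 0 -> P *m M = c *: P -> (P *m M) i j / P i j = c.
Proof. by move=> Pij ->; rewrite mxE mulfK. Qed.

Lemma mul_pair_torus (K : fieldType) n (P Q : 'M[K]_n) a :
  P *m P = P -> P *m Q = 0 -> P *m pair_torus P Q a = a *: P.
Proof.
move=> PP PQ; rewrite /pair_torus !mulmxDr !mulmxN -!scalemxAr PP PQ mulmx1.
by rewrite scaler0 oppr0 !addr0 subrr addr0.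
Qed.

Lemma pair_torusC (K : fieldType) n (P Q : 'M[K]_n) a :
  pair_torus P Q a = pair_torus Q P a^-1.
Proof. by rewrite /pair_torus invrK [_ *: P + _]addrC -!addrA [- P + _]addrC. Qed.

Lemma pair_torus_in (K : fieldType) n (J P Q : 'M[K]_n) d :
  J \in unitmx -> J^T = (-1) ^+ d *: J -> adjoint_pair J P Q -> P != 0 ->
  torus_in J (fun g => exists2 a, a != 0 & g = pair_torus P Q a).
Proof.
move=> uJ JT PQp P0.
have QPp := adjoint_pair_sym uJ JT PQp.
have [PP PQ QP PJ] := PQp; have [QQ _ _ QJ] := QPp.
have Q0 : Q != 0.
  apply: contraNneq P0 => Q0.
  by rewrite -(mulmxK uJ P) PJ Q0 trmx0 mulmx0 mul0mx.
have /matrix0Pn [i [j Pij]] := P0; have /matrix0Pn [k [l Qkl]] := Q0.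
(* Since [P *m pair_torus P Q a = a *: P], an entry where [P] does not vanish reads off [a] as a
   polynomial in the group element; [Q] likewise yields [a^-1]. *)
pose f (A : 'M[K]_n) (x y : 'I_n) : {mpoly K[n * n]} :=
  (A x y)^-1 *: (map_mx (@mpolyC (n * n) K) A *m generic_mx K n) x y.
have fE (A : 'M[K]_n) x y g : mxeval (f A x y) g = (A *m g) x y / A x y.
  rewrite /mxeval mevalZ mulrC; congr (_ / _).
  have /matrixP/(_ x y) := mxevalM (map_mx (@mpolyC (n * n) K) A) (generic_mx K n) g.
  by rewrite mxeval_map mxevalE mxE.
have fP a : mxeval (f P i j) (pair_torus P Q a) = a.
  by rewrite fE (@entry_scaled_idempotent _ _ _ _ _ _ a) ?mul_pair_torus.
have fQ a : mxeval (f Q k l) (pair_torus P Q a) = a^-1.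
  by rewrite fE (@entry_scaled_idempotent _ _ _ _ _ _ a^-1) // pair_torusC mul_pair_torus.
split; first by move=> g [a a0 ->]; apply: pair_torus_isom uJ JT PQp a0.
split.
  move=> g Tg; set a := mxeval (f P i j) g; set b := mxeval (f Q k l) g.
  (* The torus is cut out by two equations: the two coordinates are inverse to each other, and [g]
     is the corresponding combination of [P], [Q] and [1%:M - P - Q]. *)
  have ab : a * b = 1.
    apply/eqP; rewrite -subr_eq0; apply/eqP.
    have E z : mxeval (f P i j * f Q k l - 1) z =
        mxeval (f P i j) z * mxeval (f Q k l) z - 1.
      by rewrite /mxeval mevalB mevalM meval1.
    rewrite -E; apply: Tg => y [c c0 ->].
    by rewrite E fP fQ mulfV ?subrr.
  have a0 : a != 0 by apply: contra_eq_neq ab => ->; rewrite mul0r eq_sym oner_neq0.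
  have bE : b = a^-1 by rewrite -[RHS]mulr1 -ab mulKf.
  exists a => //.
  pose c (A : 'M[K]_n) := map_mx (@mpolyC (n * n) K) A.
  have := @zclosure_mx _ _ _ _ _
    (generic_mx K n - (f P i j *: c P + f Q k l *: c Q + c (1%:M - P - Q))) g Tg.
  have E y : mxeval_mx (generic_mx K n - (f P i j *: c P + f Q k l *: c Q + c (1%:M - P - Q))) y =
     y - (mxeval (f P i j) y *: P + mxeval (f Q k l) y *: Q + (1%:M - P - Q)).
    transitivity (mxeval_mx (generic_mx K n) y - (mxeval (f P i j) y *: mxeval_mx (c P) y +
      mxeval (f Q k l) y *: mxeval_mx (c Q) y + mxeval_mx (c (1%:M - P - Q)) y)).
      by rewrite /mxeval_mx map_mxB !map_mxD !map_mxZ.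
    by rewrite mxevalE !mxeval_map.
  rewrite E -/a -/b => /(_ _)/eqP; rewrite subr_eq0 bE => H; apply/eqP; apply: H.
  by move=> y [s s0 ->]; rewrite E fP fQ subrr.
exists 1%N, (fun s => pair_torus P Q (s ord0)); split.
- move=> g; split=> [[a a0 ->]|[s s0 ->]]; first by exists (fun=> a).
  by exists (s ord0).
- by move=> a b a0 b0; rewrite pair_torusM.
(* Laurent form with denominator a and numerator a^2 P + Q + a (1 - P - Q). *)
- exists (\matrix_(x, y) ((P x y) *: ('X_ord0 * 'X_ord0) + (Q x y)%:MP +
      ((1%:M - P - Q) x y) *: 'X_ord0)), 1%N.
  move=> a a0; rewrite big_ord_recl big_ord0 mulr1 expr1.
  apply/matrixP => x y; rewrite !mxE !(mevalD, mevalZ, mevalM, mevalXU, mevalC).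
  move: (a ord0) (a0 ord0) ((x == y)%:R) (P x y) (Q x y) => t t0 u v w.
  by field; exact: t0.
exists (fun=> f P i j) => a a0 i0; rewrite fP; congr (a _).
by apply: val_inj; case: i0 => [[]].
Qed.

(** Matrix counterpart of being distinguished ([distinguished_pair_free],
    [pair_free_distinguished]); it can be decided by rank arguments. *)
Definition pair_free (K : fieldType) n (J y : 'M[K]_n) :=
  forall P Q, adjoint_pair J P Q -> P *m y = y *m P -> P = 0.

Lemma distinguished_pair_free (K : closedFieldType) n (J y : 'M[K]_n) d :
  2%:R != 0 :> K ->
  J \in unitmx -> J^T = (-1) ^+ d *: J -> distinguished J y ->
  pair_free J y.
Proof.
move=> two0 uJ JT [[ly _] dy] P Q PQp Py; apply/eqP/negPn/negP => P0.
have Qy : Q *m y = y *m Q.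
  by case: PQp => _ _ _ PJ; apply: adjoint_pair_commute PJ Py.
(* A parameter with [a ^+ 2 != 1], since centrality only yields [a = a^-1]. *)
have [a a0] := @exists_expr_neq K 2 0 isT.
rewrite expr0 => /eqP; apply.
suff aV : a = a^-1 by rewrite expr2 {1}aV mulVf.
apply: (pair_torus_noncentral two0 uJ JT PQp P0 a0).
apply: (dy _ (pair_torus_in uJ JT PQp P0)); last by exists a.
move=> g [b b0 ->]; have gJ := pair_torus_isom uJ JT PQp b0.
split=> //; have ug := isom_unit uJ gJ.
apply: (canLR (mulmxK ug)); rewrite /pair_torus !mulmxDl !mulmxDr.
by rewrite !mulNmx !mulmxN -!scalemxAl -!scalemxAr Py Qy mulmx1 mul1mx.
Qed.

(** * Weights of cocharacters *)

Lemma laurent_mx_coefs (K : fieldType) n (P : 'M[{poly K}]_n) :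
  exists M (C : 'I_M -> 'M[K]_n), forall a,
    map_mx (fun p => p.[a]) P = \sum_(i < M) a ^+ i *: C i.
Proof.
pose M := \max_(u : 'I_n) \max_(v : 'I_n) size (P u v).
exists M, (fun i => \matrix_(u, v) (P u v)`_i) => a.
apply/matrixP => u v; rewrite summxE mxE (@horner_coef_wide _ M).
  by apply: eq_bigr => i _; rewrite !mxE mulrC.
by rewrite (leq_trans _ (leq_bigmax u)) // (leq_trans _ (leq_bigmax v)).
Qed.

Lemma cocharacter1 (K : fieldType) n (J : 'M[K]_n) lam :
  J \in unitmx -> cocharacter J lam -> lam 1 = 1%:M.
Proof.
move=> uJ [lJ lM _]; have ul := isom_unit uJ (lJ 1 (oner_neq0 _)).
by apply: (can_inj (mulKmx ul)); rewrite -lM ?oner_neq0 // mulr1 mulmx1.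
Qed.

(** Comparing coefficients in [lam (a * b) = lam a *m lam b], first in [b] and then in [a], makes
    the [C i] orthogonal idempotents; [C i] projects onto the space of weight i - k. *)
Lemma cocharacter_weights (K : closedFieldType) n (J : 'M[K]_n) lam :
  J \in unitmx -> cocharacter J lam ->
  exists M (C : 'I_M -> 'M[K]_n) k,
    [/\ forall a, a != 0 -> a ^+ k *: lam a = \sum_(i < M) a ^+ i *: C i,
        forall i j, C i *m C j = if i == j then C j else 0 &
        \sum_i C i = 1%:M].
Proof.
move=> uJ coc; have l1 := cocharacter1 uJ coc; case: coc => lJ lM [P [k lE]].
have [M [C CE]] := laurent_mx_coefs P; exists M, C, k.
have lC a : a != 0 -> a ^+ k *: lam a = \sum_(i < M) a ^+ i *: C i.
  by move=> a0; rewrite -CE lE // scalerA mulfV ?scale1r // expf_neq0.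
split=> //; last first.
  have := lC 1 (oner_neq0 _); rewrite expr1n scale1r l1 => ->.
  by apply: eq_bigr => i _; rewrite expr1n scale1r.
have step a : a != 0 -> forall j : 'I_M, a ^+ j *: C j = \sum_(i < M) a ^+ i *: (C i *m C j).
  move=> a0; apply: eq_pow_sum => b b0.
  transitivity ((a * b) ^+ k *: lam (a * b)).
    by rewrite lC ?mulf_neq0 //; apply: eq_bigr => i _; rewrite scalerA -exprMn mulrC.
  rewrite lM // exprMn -scalerA scalemxAr scalemxAl !lC // mulmx_sumr.
  apply: eq_bigr => j _; rewrite -scalemxAr mulmx_suml; congr (_ *: _).
  by apply: eq_bigr => i _; rewrite -scalemxAl.
move=> i j; suff /(_ i) <- : forall i, (if i == j then C j else 0) = C i *m C j by [].
apply: (@eq_pow_sum _ _ _ (fun i => if i == j then C j else 0)) => a a0.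
rewrite -step // (bigD1 j) //= eqxx big1 ?addr0 //.
by move=> l /negbTE ->; rewrite scaler0.
Qed.

Lemma cocharacter_centralizing (K : closedFieldType) n (J y : 'M[K]_n) lam :
  J \in unitmx -> cocharacter J lam ->
  (forall a, a != 0 -> lam a *m y = y *m lam a) ->
  (forall a, a != 0 -> lam a = 1%:M) \/
  exists P Q, [/\ adjoint_pair J P Q, P != 0 & P *m y = y *m P].
Proof.
move=> uJ coc ly; have [M [C [k [lC CC C1]]]] := cocharacter_weights uJ coc.
have [lJ _ _] := coc.
have Cl i a : a != 0 -> a ^+ k *: (C i *m lam a) = a ^+ i *: C i.
  move=> a0; rewrite scalemxAr lC // mulmx_sumr (bigD1 i) //= -scalemxAr CC eqxx.
  by rewrite big1 ?addr0 // => j ji; rewrite -scalemxAr CC eq_sym (negbTE ji) scaler0.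
(* Invariance of the form: only opposite weights i - k and j - k can pair nontrivially. *)
have CJC (i j : 'I_M) : (i + j != k + k)%N -> C i *m J *m (C j)^T = 0.
  move=> ijk; have [a a0 aij] := exists_expr_neq K ijk.
  have : (a ^+ k *: (C i *m lam a)) *m J *m (a ^+ k *: (C j *m lam a))^T =
      a ^+ (k + k) *: (C i *m J *m (C j)^T).
    rewrite linearZ /= trmx_mul -!scalemxAl -scalemxAr scalerA -exprD !mulmxA.
    by rewrite -(mulmxA (C i) _ J) -(mulmxA (C i) (_ *m _)) lJ.
  rewrite !Cl // linearZ /= -!scalemxAl -scalemxAr scalerA -exprD => /eqP.
  by rewrite -subr_eq0 -scalerBl scaler_eq0 subr_eq0 (negbTE aij) => /eqP.
have Cy i : C i *m y = y *m C i.
  move: i; apply: eq_pow_sum => a a0.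
  transitivity (a ^+ k *: (lam a *m y)).
    by rewrite scalemxAl lC // mulmx_suml; apply: eq_bigr => i _; rewrite scalemxAl.
  by rewrite ly // scalemxAr lC // mulmx_sumr; apply: eq_bigr => i _; rewrite scalemxAr.
case: (boolP [forall i : 'I_M, (i != k :> nat) ==> (C i == 0)]) => [/forallP H|].
  left=> a a0; apply: (scalerI (_ : a ^+ k != 0)); first by rewrite expf_neq0.
  rewrite lC // -C1 scaler_sumr; apply: eq_bigr => i _.
  have := H i; case: eqVneq => [->//|_] /= /eqP->; by rewrite !scaler0.
rewrite negb_forall => /existsP[i]; rewrite negb_imply => /andP[ik Ci0]; right.
have CJ : C i *m J = \sum_j C i *m J *m (C j)^T.
  by rewrite -mulmx_sumr -linear_sum /= C1 trmx1 mulmx1.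
(* By nondegeneracy a nonzero [C i] pairs with some [C j], which also shows that the index 2k - i is
   in range. *)
have [j ij] : exists j : 'I_M, (i + j = k + k)%N.
  case: (boolP [exists j : 'I_M, i + j == k + k]%N) => [/existsP[j /eqP]|]; first by exists j.
  rewrite negb_exists => /forallP H; case/eqP: Ci0.
  by rewrite -(mulmxK uJ (C i)) CJ big1 ?mul0mx // => j _; rewrite CJC.
have ji : j != i by apply: contraNneq ik => ji; move: ij; rewrite ji; lia.
exists (C i), (C j); split=> //; split.
- by rewrite CC eqxx.
- by rewrite CC eq_sym (negbTE ji).
- by rewrite CC (negbTE ji).
have -> : J *m (C j)^T = \sum_l C l *m J *m (C j)^T.
  by rewrite -!mulmx_suml C1 mul1mx.
rewrite CJ (bigD1 j) //= [RHS](bigD1 i) //= !big1 // => l lij; apply: CJC.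
  by apply: contra_neq lij => e; apply: val_inj => /=; lia.
by apply: contra_neq lij => e; apply: val_inj => /=; lia.
Qed.

(** Replacing a by b a conjugates the path by [lam b]. Written without inverses this is a polynomial
    identity in a, hence it also holds at a = 0. *)
Lemma limit_fixed (K : closedFieldType) n (J x y : 'M[K]_n) lam :
  J \in unitmx -> cocharacter J lam -> is_limit lam x y ->
  forall b, b != 0 -> lam b *m y = y *m lam b.
Proof.
move=> uJ [lJ lM _] [Q [QE ->]] b b0.
have ub := isom_unit uJ (lJ b b0).
pose PL := map_mx (@polyC K) (lam b) *m Q.
pose PR := (map_mx (fun p => p \Po (b *: 'X)) Q) *m map_mx (@polyC K) (lam b).
have EL a : map_mx (fun p => p.[a]) PL = lam b *m map_mx (fun p => p.[a]) Q.
  rewrite -[map_mx _ PL]/(map_mx (horner_eval a) PL) map_mxM; congr (_ *m _).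
  by apply/matrixP => i j; rewrite !mxE; apply: hornerC.
have ER a : map_mx (fun p => p.[a]) PR = map_mx (fun p => p.[b * a]) Q *m lam b.
  rewrite -[map_mx _ PR]/(map_mx (horner_eval a) PR) map_mxM; congr (_ *m _).
    by apply/matrixP => i j; rewrite !mxE; rewrite -[LHS]/(_.[_]) horner_comp !hornerE.
  by apply/matrixP => i j; rewrite !mxE; apply: hornerC.
have PLR : PL = PR.
  apply/matrixP => i j; apply: eq_poly_off0 => a a0.
  have : map_mx (fun p => p.[a]) PL = map_mx (fun p => p.[a]) PR.
    rewrite EL ER -!QE ?mulf_neq0 // lM // invmxM ?(isom_unit uJ (lJ _ _)) //.
    by rewrite !mulmxA mulmxKV.
  by move/matrixP/(_ i j); rewrite !mxE.
by rewrite -EL PLR ER mulr0.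
Qed.

Lemma adjoint_pair_conj (K : fieldType) n (J P Q g : 'M[K]_n) :
  J \in unitmx -> isom J g -> adjoint_pair J P Q ->
  adjoint_pair J (g *m P *m invmx g) (g *m Q *m invmx g).
Proof.
move=> uJ gJ [PP PQ QP PJ]; have ug := isom_unit uJ gJ.
have VJ : invmx g *m J = J *m g^T by rewrite -{1}gJ !mulmxA mulVmx // mul1mx.
split; rewrite ?mulmxA ?(mulmxKV ug).
- by rewrite -(mulmxA g) PP.
- by rewrite -(mulmxA g) PQ mulmx0 mul0mx.
- by rewrite -(mulmxA g) QP mulmx0 mul0mx.
rewrite -mulmxA VJ !trmx_mul !mulmxA -(mulmxA g) PJ mulmxA; congr (_ *m _ *m _).
by rewrite -[in RHS]gJ -!mulmxA -trmx_mul mulVmx // trmx1 mulmx1.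
Qed.

Lemma pair_free_orbit (K : fieldType) n (J x y : 'M[K]_n) :
  J \in unitmx -> pair_free J y -> orbit J x y -> pair_free J x.
Proof.
move=> uJ fy [h hJ yE] P Q PQp Px; have uh := isom_unit uJ hJ.
apply/eqP; rewrite -(conj_eq0 _ uh); apply/eqP.
apply: fy (adjoint_pair_conj uJ hJ PQp) _.
by rewrite yE !mulmxA !(mulmxKV uh) -!(mulmxA h) Px.
Qed.

Lemma accessible1_pair_free (K : closedFieldType) n (J x y : 'M[K]_n) :
  J \in unitmx -> pair_free J y -> accessible1 J x y -> orbit J x y.
Proof.
move=> uJ fy [lam [x' [y' [coc xx' lim yy']]]].
have fix_y' := limit_fixed uJ coc lim.
case: (cocharacter_centralizing uJ coc fix_y') => [l1|[P [Q [PQp P0 Py]]]].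
  suff y'x' : y' = x' by rewrite y'x' in yy'; apply: orbit_trans xx' (orbit_sym uJ yy').
  have [R [RE ->]] := lim; apply/matrixP => i j; rewrite mxE.
  suff -> : R i j = (x' i j)%:P by rewrite hornerC.
  apply: eq_poly_off0 => a a0; rewrite hornerC.
  have /matrixP/(_ i j) := RE a a0; rewrite l1 // mul1mx invmx1 mulmx1 => ->.
  by rewrite mxE.
case/eqP: P0; exact: (pair_free_orbit uJ fy (orbit_sym uJ yy') PQp Py).
Qed.

Lemma accessible_pair_free (K : closedFieldType) n (J x y : 'M[K]_n) :
  J \in unitmx -> pair_free J y -> accessible J x y -> orbit J x y.
Proof.
(* The chain is read from its end: [pair_free] is known for the last element, and is carried
   backwards once the last step is seen to stay in one orbit. *)
move=> uJ fy /clos_rt_rtn1_iff xy.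
elim: xy fy => [|z w zw _ IH] fw; first exact: orbit_refl.
have ozw := accessible1_pair_free uJ fw zw.
exact: orbit_trans (IH (pair_free_orbit uJ fw ozw)) ozw.
Qed.

(** * Lines of nilpotent elements *)

(* For t = 0 the last condition also bounds the nilpotency index of z. *)
Definition pencil (K : fieldType) n (J : 'M[K]_n) d (z : 'M[K]_n) :=
  exists w, [/\ lie J w, w ^+ d != 0 & forall t, (z + t *: w) ^+ d.+1 = 0].

Lemma pencil_conj (K : fieldType) n (J E z : 'M[K]_n) d : E \in unitmx ->
  pencil (E *m J *m E^T) d (E *m z *m invmx E) -> pencil J d z.
Proof.
move=> uE [w [lw wd pw]]; have uV : invmx E \in unitmx by rewrite unitmx_inv.
exists (invmx E *m w *m E); split.
- have := lie_conj uV lw; rewrite invmxK !mulmxA mulVmx // mul1mx.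
  by rewrite -(mulmxA J) -trmx_mul mulVmx // trmx1 mulmx1.
- have := conj_exp w d uV; rewrite invmxK => ->.
  by have := conj_eq0 (w ^+ d) uV; rewrite invmxK => ->.
move=> t; apply/eqP; rewrite -(conj_eq0 _ uE) -conj_exp // mulmxDr mulmxDl.
by rewrite -scalemxAr -scalemxAl !mulmxA mulmxV // mul1mx mulmxK // pw.
Qed.

Lemma form_neq0 (K : fieldType) n (S : 'M[K]_n) (u : 'rV[K]_n) :
  u *m S != 0 -> exists v, form S u v = 1.
Proof.
case/rV0Pn => j uj; exists (((u *m S) 0 j)^-1 *: delta_mx 0 j).
by rewrite formZr /form trmx_delta -colE [X in _ * X]mxE mulVf.
Qed.

(* Gram matrix in a basis f, B, v with f and v isotropic, form f v = 1, and B a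
   basis of the orthogonal complement of f and v. *)
Definition split_gram (K : fieldType) n (e : K) (J : 'M[K]_n) : 'M[K]_(1 + (n + 1)) :=
  block_mx 0 (row_mx 0 1%:M) (col_mx 0 e%:M) (block_mx J 0 0 0).

Lemma mul_split_gram (K : fieldType) m n (e : K) (J : 'M[K]_n) a b (c : 'M[K]_(m, 1)) :
  row_mx a (row_mx b c) *m split_gram e J = row_mx (e *: c) (row_mx (b *m J) a).
Proof.
rewrite /split_gram !mul_row_block !mulmx0 !mul_row_col !mulmx0 !add0r !addr0.
by rewrite mul_mx_scalar mul_mx_row mulmx0 mulmx1 add_row_mx add0r addr0.
Qed.

(** The given [v] becomes the last basis vector, so that elements killing it have zero last row. *)
Lemma hyperbolic_splitting (K : fieldType) n (J : 'M[K]_(1 + (n + 1))) e v :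
  2%:R != 0 :> K -> J \in unitmx -> J^T = e *: J -> e * e = 1 ->
  v != 0 -> form J v v = 0 ->
  exists E (J' : 'M[K]_n),
    [/\ E \in unitmx, E *m J *m E^T = split_gram e J', J' \in unitmx,
        J'^T = e *: J' & row_mx 0 (row_mx 0 1%:M) *m E = v].
Proof.
move=> two0 uJ JT ee v0 vv.
have e0 : e != 0 by apply: contra_eq_neq ee => ->; rewrite mul0r eq_sym oner_neq0.
have fC u w : form J w u = e * form J u w by rewrite -form_tr JT formZm.
have [u vu] : exists u, form J v u = 1.
  apply: form_neq0; apply: contraNneq v0 => vJ.
  by rewrite -(mulmxK uJ v) vJ mul0mx.
have [f1 f1v] : exists f1, form J f1 v = 1.
  by exists (e *: u); rewrite formZl fC vu mulr1.
(* A multiple of [v] makes [f1] isotropic. The equation [c] treats both signs at once: in the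
   alternating case it says that the value is already 0. *)
have [f [fv ff]] : exists f, form J f v = 1 /\ form J f f = 0.
  exists (f1 - (2%:R^-1 * form J f1 f1) *: v); split.
    by rewrite !formB f1v vv; ring.
  have c : e * form J f1 f1 = form J f1 f1 by rewrite -fC.
  rewrite !formB f1v vv (fC f1 v) f1v.
  move: (form J f1 f1) c => c ec.
  transitivity (c - 2%:R^-1 * (c + e * c)); first by ring.
  by rewrite ec; field.
have vf : form J v f = e by rewrite fC fv mulr1.
pose M : 'M_(_, 1 + 1) := row_mx (J *m v^T) (J *m f^T).
have GM : col_mx f v *m M = block_mx 1%:M 0 0 e%:M.
  by rewrite mul_col_row !mulmxA !formE fv ff vv vf -(rmorph0 (@scalar_mx _ 1)).
have rM : \rank M = 2.
  apply/eqP; rewrite eqn_leq (rank_leq_col M) /=.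
  apply: leq_trans (mxrankM_maxr (col_mx f v) M); rewrite GM mxrank_unit //.
  by rewrite unitmxE det_ublock det1 mul1r -unitmxE unitmxE det_scalar1 unitfE.
have [B rB kB] : exists2 B : 'M_(n, 1 + (n + 1)), row_free B & B *m M = 0.
  have rk : \rank (kermx M) = n by rewrite mxrank_ker rM; lia.
  exists (castmx (rk, erefl) (row_base (kermx M))).
    by rewrite /row_free eqmx_cast eq_row_base rk.
  by apply/sub_kermxP; rewrite eqmx_cast eq_row_base.
move: kB; rewrite mul_mx_row => /eqP; rewrite row_mx_eq0 !mulmxA => /andP[/eqP Bv /eqP Bf].
have trB (w : 'rV_(1 + (n + 1))) : B *m J *m w^T = 0 -> w *m J *m B^T = 0.
  move=> Bw; apply: trmx_inj; rewrite !trmx_mul trmxK JT mulmxA -scalemxAr -scalemxAl.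
  by rewrite Bw scaler0 trmx0.
pose E := col_mx f (col_mx B v); exists E, (B *m J *m B^T).
have EJE : E *m J *m E^T = split_gram e (B *m J *m B^T).
  rewrite /E !tr_col_mx !mul_col_mx !mul_mx_row !formE fv ff vv vf Bv Bf !trB //.
  by rewrite /split_gram raddf0 !block_mxEv -block_mxEh block_mxEv.
have uE : E \in unitmx.
  rewrite -row_free_unit; apply: inj_row_free => x.
  rewrite -[x]hsubmxK -[rsubmx x]hsubmxK.
  move: (lsubmx x) (lsubmx (rsubmx x)) (rsubmx (rsubmx x)) => a b c xE.
  have := congr1 (mulmx^~ (J *m E^T)) xE.
  rewrite mul0mx -mulmxA (mulmxA E) EJE mul_split_gram => /eqP.
  rewrite !row_mx_eq0 scaler_eq0 (negbTE e0) => /and3P[/eqP c0 _ /eqP a0].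
  move: xE; rewrite /E !mul_row_col a0 c0 !mul0mx add0r addr0 => bB.
  have := mulmx_free_eq0 b rB; rewrite bB eqxx => /esym/eqP->.
  by rewrite !row_mx0.
split=> //.
- rewrite -row_free_unit; apply: inj_row_free => b bJ.
  have uG : split_gram e (B *m J *m B^T) \in unitmx.
    by rewrite -EJE !unitmx_mul unitmx_tr uE uJ.
  have : row_mx 0 (row_mx b 0) *m split_gram e (B *m J *m B^T) = 0.
    by rewrite mul_split_gram bJ scaler0 !row_mx0.
  move/(canRL (mulmxK uG)); rewrite mul0mx => /eqP.
  by rewrite !row_mx_eq0 => /and3P[_ /eqP].
- by rewrite !trmx_mul trmxK JT -scalemxAl -scalemxAr mulmxA.
by rewrite /E !mul_row_col !mul0mx mul1mx !add0r.
Qed.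

Lemma block_nilp_exp (K : fieldType) m n (b : 'M[K]_(m, n)) (X : 'M_n) k :
  (block_mx 0 b 0 X : 'M_(m + n)) ^+ k.+1 = block_mx 0 (b *m X ^+ k) 0 (X ^+ k.+1).
Proof.
elim: k => [|k IH]; first by rewrite !expr1 expr0 mulmx1.
rewrite exprSr IH -mulmxE mulmx_block !mulmx0 !mul0mx !add0r.
by rewrite -mulmxA mulmxE -!exprSr.
Qed.

Lemma block_nilp_exp_l (K : fieldType) m n (c : 'M[K]_(m, n)) (Y : 'M_m) k :
  (block_mx Y c 0 0 : 'M_(m + n)) ^+ k.+1 = block_mx (Y ^+ k.+1) (Y ^+ k *m c) 0 0.
Proof.
elim: k => [|k IH]; first by rewrite !expr1 expr0 mul1mx.
rewrite exprS IH -mulmxE mulmx_block !mulmx0 !mul0mx !addr0.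
by rewrite mulmxA mulmxE -!exprS.
Qed.

(** In the basis of [split_gram], an element that kills [v] and has image in v^perp: [Y] is its
    action on v^perp / v, while [b] and [a] are the coordinates of the image of [f]. *)
Definition strict_block (K : fieldType) n (b : 'rV[K]_n) (a : 'M[K]_1) (Y : 'M[K]_n)
  (c : 'cV[K]_n) : 'M[K]_(1 + (n + 1)) := block_mx 0 (row_mx b a) 0 (block_mx Y c 0 0).

Lemma strict_block_exp (K : fieldType) n (b : 'rV[K]_n) a (Y : 'M[K]_n) c k :
  strict_block b a Y c ^+ k.+2 =
  strict_block (b *m Y ^+ k.+1) (b *m Y ^+ k *m c) (Y ^+ k.+2) (Y ^+ k.+1 *m c).
Proof.
rewrite /strict_block block_nilp_exp !block_nilp_exp_l mul_row_block.
by rewrite !mulmx0 !addr0 mulmxA.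
Qed.

Lemma strict_block_pencil (K : fieldType) n (b b' : 'rV[K]_n) a a' (Y Y' : 'M[K]_n) c c' t :
  strict_block b a Y c + t *: strict_block b' a' Y' c' =
  strict_block (b + t *: b') (a + t *: a') (Y + t *: Y') (c + t *: c').
Proof.
by rewrite /strict_block !scale_block_mx !scale_row_mx !add_block_mx !add_row_mx !scaler0 !addr0.
Qed.

Definition tri_mx (K : fieldType) n (a11 : 'M[K]_1) (a12 : 'rV[K]_n) (a13 : 'M[K]_1)
    (a21 : 'cV[K]_n) (a22 : 'M[K]_n) (a23 : 'cV[K]_n)
    (a31 : 'M[K]_1) (a32 : 'rV[K]_n) (a33 : 'M[K]_1) : 'M[K]_(1 + (n + 1)) :=
  block_mx a11 (row_mx a12 a13) (col_mx a21 a31) (block_mx a22 a23 a32 a33).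

Lemma tri_mxP (K : fieldType) n (z : 'M[K]_(1 + (n + 1))) :
  exists a11 a12 a13 a21 a22 a23 a31 a32 a33,
    z = tri_mx a11 a12 a13 a21 a22 a23 a31 a32 a33.
Proof.
exists (ulsubmx z), (lsubmx (ursubmx z)), (rsubmx (ursubmx z)),
  (usubmx (dlsubmx z)), (ulsubmx (drsubmx z)), (ursubmx (drsubmx z)),
  (dsubmx (dlsubmx z)), (dlsubmx (drsubmx z)), (drsubmx (drsubmx z)).
by rewrite /tri_mx hsubmxK vsubmxK !submxK.
Qed.

Lemma tri_mx_split_gram (K : fieldType) n (J : 'M[K]_n) e a11 a12 a13 a21 a22 a23 a31 a32 a33 :
  tri_mx a11 a12 a13 a21 a22 a23 a31 a32 a33 *m split_gram e J =
  tri_mx (e *: a13) (a12 *m J) a11 (e *: a23) (a22 *m J) a21 (e *: a33) (a32 *m J) a31.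
Proof.
rewrite /split_gram /tri_mx mulmx_block; congr block_mx.
- by rewrite mulmx0 add0r mul_row_col mulmx0 add0r mul_mx_scalar.
- by rewrite mul_mx_row mulmx0 mulmx1 mul_row_block !mulmx0 !addr0 add_row_mx add0r addr0.
- by rewrite mulmx0 add0r mul_block_col !mulmx0 !mul_mx_scalar !add0r.
rewrite mul_mx_row mulmx0 mulmx1 mulmx_block !mulmx0 !addr0.
by rewrite [block_mx _ 0 _ 0]block_mxEh add_row_mx col_mx0 add0r addr0 -block_mxEh.
Qed.

Lemma tr_tri_mx (K : fieldType) n a11 a12 a13 a21 (a22 : 'M[K]_n) a23 a31 a32 a33 :
  (tri_mx a11 a12 a13 a21 a22 a23 a31 a32 a33)^T =
  tri_mx a11^T a21^T a31^T a12^T a22^T a32^T a13^T a23^T a33^T.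
Proof. by rewrite /tri_mx tr_block_mx tr_row_mx tr_col_mx tr_block_mx. Qed.

Lemma add_tri_mx (K : fieldType) n a11 a12 a13 a21 (a22 : 'M[K]_n) a23 a31 a32 a33
    b11 b12 b13 b21 b22 b23 b31 b32 b33 :
  tri_mx a11 a12 a13 a21 a22 a23 a31 a32 a33 + tri_mx b11 b12 b13 b21 b22 b23 b31 b32 b33 =
  tri_mx (a11 + b11) (a12 + b12) (a13 + b13) (a21 + b21) (a22 + b22) (a23 + b23)
    (a31 + b31) (a32 + b32) (a33 + b33).
Proof. by rewrite /tri_mx add_block_mx add_row_mx add_col_mx add_block_mx. Qed.

Lemma scale_tri_mx (K : fieldType) n c a11 a12 a13 a21 (a22 : 'M[K]_n) a23 a31 a32 a33 :
  c *: tri_mx a11 a12 a13 a21 a22 a23 a31 a32 a33 =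
  tri_mx (c *: a11) (c *: a12) (c *: a13) (c *: a21) (c *: a22) (c *: a23)
    (c *: a31) (c *: a32) (c *: a33).
Proof. by rewrite /tri_mx scale_block_mx scale_row_mx scale_col_mx scale_block_mx. Qed.

Lemma tri_mx_eq0 (K : fieldType) n a11 a12 a13 a21 (a22 : 'M[K]_n) a23 a31 a32 a33 :
  tri_mx a11 a12 a13 a21 a22 a23 a31 a32 a33 = 0 <->
  [/\ [/\ a11 = 0, a12 = 0 & a13 = 0], [/\ a21 = 0, a22 = 0 & a23 = 0] &
      [/\ a31 = 0, a32 = 0 & a33 = 0]].
Proof.
split=> [/eqP|[[-> -> ->] [-> -> ->] [-> -> ->]]].
  rewrite /tri_mx !block_mx_eq0 row_mx_eq0 col_mx_eq0.
  case/and4P => /eqP-> /andP[/eqP-> /eqP->] /andP[/eqP-> /eqP->].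
  by case/and4P => /eqP-> /eqP-> /eqP-> /eqP->.
by rewrite /tri_mx row_mx0 col_mx0 !block_mx0.
Qed.

Lemma strict_blockE (K : fieldType) n (b : 'rV[K]_n) a Y c :
  strict_block b a Y c = tri_mx 0 b a 0 Y c 0 0 0.
Proof. by rewrite /tri_mx col_mx0. Qed.

Lemma lie_signed (K : fieldType) n (J z : 'M[K]_n) e :
  J^T = e *: J -> e * e = 1 -> lie J z <-> z *m J + e *: (z *m J)^T = 0.
Proof.
move=> JT ee; rewrite /lie trmx_mul JT -scalemxAl scalerA ee scale1r //.
Qed.

Lemma split_gram_tr (K : fieldType) n (J : 'M[K]_n) e :
  J^T = e *: J -> e * e = 1 -> (split_gram e J)^T = e *: split_gram e J.
Proof.
move=> JT ee; have E : split_gram e J = tri_mx 0 0 1%:M 0 J 0 e%:M 0 0 by [].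
rewrite E tr_tri_mx scale_tri_mx JT !trmx0 !scaler0 tr_scalar_mx trmx1.
by rewrite scalemx1 scale_scalar_mx ee.
Qed.

(** By skewness an element killing [v] has image orthogonal to [v], whence the zero first column;
    skewness also determines the last column by [b]. *)
Lemma lie_split_gram (K : fieldType) n (J : 'M[K]_n) e (z : 'M[K]_(1 + (n + 1))) :
  J^T = e *: J -> e * e = 1 ->
  lie (split_gram e J) z -> row_mx 0 (row_mx 0 1%:M) *m z = 0 ->
  exists b a Y, z = strict_block b a Y (- (b *m J)^T) /\ lie J Y.
Proof.
move=> JT ee /(lie_signed _ (split_gram_tr JT ee) ee).
have [a11 [a12 [a13 [a21 [a22 [a23 [a31 [a32 [a33 ->]]]]]]]]] := tri_mxP z.
rewrite tri_mx_split_gram tr_tri_mx scale_tri_mx add_tri_mx => /tri_mx_eq0.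
case=> [[_ _ A13] [B21 B22 _] [_ B32 _]] /eqP.
rewrite /tri_mx !mul_row_block mul_row_col !mul0mx.
rewrite !mul1mx !add0r !row_mx_eq0 => /and3P[/eqP a310 /eqP a320 /eqP a330].
have e0 : e != 0 by apply: contra_eq_neq ee => ->; rewrite mul0r eq_sym oner_neq0.
exists a12, a13, a22; split; last exact/(lie_signed _ JT ee).
rewrite strict_blockE a310 a320 a330; congr tri_mx.
- by move: A13; rewrite a330 scaler0 trmx0 scaler0 addr0.
- by move: B32; rewrite a320 mul0mx add0r => /eqP; rewrite scaler_eq0 (negbTE e0) trmx_eq0 => /eqP.
by move/eqP: B21; rewrite -scalerDr scaler_eq0 (negbTE e0) addr_eq0 => /eqP.
Qed.

Lemma split_gram_lie (K : fieldType) n (J : 'M[K]_n) e b (Y : 'M[K]_n) :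
  J^T = e *: J -> e * e = 1 -> lie J Y ->
  lie (split_gram e J) (strict_block b 0 Y (- (b *m J)^T)).
Proof.
move=> JT ee /(lie_signed _ JT ee) lY; apply/(lie_signed _ (split_gram_tr JT ee) ee).
rewrite strict_blockE tri_mx_split_gram tr_tri_mx scale_tri_mx add_tri_mx.
apply/tri_mx_eq0; rewrite !(mul0mx, scaler0, trmx0, addr0, add0r).
split; split=> //; last by rewrite scalerN addNr.
by rewrite linearZ linearN /= trmxK scalerA ee scale1r subrr.
Qed.

(* A nilpotent z with v z = 0 acts on v^perp / v; a regular element w' there is
   extended by a vector b' with form (w'^d J) b' b' != 0. *)
Lemma pencil_split (K : closedFieldType) n (J : 'M[K]_n) d (z : 'M[K]_(1 + (n + 1))) :
  2%:R != 0 :> K -> J \in unitmx -> J^T = (-1) ^+ d *: J ->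
  (forall Y, nilp J Y -> pencil J d Y) ->
  nilp (split_gram ((-1) ^+ d) J) z -> row_mx 0 (row_mx 0 1%:M) *m z = 0 ->
  pencil (split_gram ((-1) ^+ d) J) d.+2 z.
Proof.
move=> two0 uJ JT IH [lz [k zk]] z3.
have ee : (-1) ^+ d * (-1) ^+ d = 1 :> K by rewrite -expr2 sqrr_sign.
have [b [a [Y [zE lY]]]] := lie_split_gram JT ee lz z3.
have nY : nilp J Y.
  split=> //; exists k.+2; have : z ^+ k.+2 = 0 by rewrite -addn2 exprD zk mul0r.
  by rewrite zE strict_block_exp strict_blockE => /tri_mx_eq0[_ []].
have [w' [lw' w'd pw]] := IH Y nY.
(* The sign (-1)^d of [J] cancels the factor (-1)^d that comes from the skewness of [w']. *)
have sym : (w' ^+ d *m J)^T = w' ^+ d *m J.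
  rewrite trmx_mul JT -scalemxAl lie_exp_tr // scalerA ee scale1r //.
have [|b' b'1] := symmetric_unit_vector two0 sym.
  by apply: contraNneq w'd => w0; rewrite -(mulmxK uJ (_ ^+ d)) w0 mul0mx.
exists (strict_block b' 0 w' (- (b' *m J)^T)); split.
- exact: split_gram_lie.
(* The corner of the power is, up to sign, [form (w' ^+ d *m J) b' b'], which is 1. *)
- apply/eqP; rewrite strict_block_exp strict_blockE => /tri_mx_eq0[[_ _ c0] _ _].
  move/eqP: c0; rewrite trmx_mul JT -scalemxAl mulmxN -scalemxAr oppr_eq0.
  rewrite scaler_eq0 signr_eq0 /= !mulmxA => /eqP c0.
  have := b'1; rewrite /form !mulmxA c0 mxE => /esym/eqP.
  by rewrite oner_eq0.
move=> t; rewrite zE strict_block_pencil strict_block_exp pw.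
have p2 : (Y + t *: w') ^+ d.+2 = 0 by rewrite exprS pw mulr0.
have p3 : (Y + t *: w') ^+ d.+3 = 0 by rewrite exprS p2 mulr0.
by rewrite p2 p3 !(mulmx0, mul0mx) strict_blockE; apply/tri_mx_eq0; split.
Qed.

Lemma alternating_rank (K : fieldType) n (S : 'M[K]_n) :
  2%:R != 0 :> K -> S^T = - S -> S != 0 -> (1 < \rank S)%N.
Proof.
move=> two0 ST S0.
have [u /form_neq0[v uv]] : exists u : 'rV_n, u *m S != 0.
  have /rowV0Pn[w /submxP[u ->]] := S0; by exists u.
have vu : form S v u = -1 by rewrite -form_tr ST -scaleN1r formZm uv mulr1.
have uu := alternating_form u two0 ST; have vv := alternating_form v two0 ST.
pose G := col_mx u v *m S *m row_mx u^T v^T.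
have GE : G = block_mx 0 1%:M (- 1%:M) 0.
  rewrite /G mul_col_mx mul_col_row !formE uu vv uv vu.
  by rewrite -!(raddf0 (@scalar_mx _ 1)) -(rmorphN (@scalar_mx _ 1)).
have uG : G \in unitmx.
  have [] // := @mulmx1_unit _ _ G (block_mx 0 (- 1%:M) 1%:M 0).
  rewrite GE mulmx_block !(mulmx0, mul0mx, mulmxN, mulNmx, mulmx1, mul1mx).
  by rewrite ?opprK !(add0r, addr0, oppr0) -scalar_mx_block.
suff : (\rank G <= \rank S)%N by rewrite mxrank_unit.
by rewrite (leq_trans (mxrankM_maxl _ _)) // mxrankM_maxr.
Qed.

Lemma nilp_kernel (K : fieldType) n (z : 'M[K]_n) k :
  (0 < n)%N -> z ^+ k = 0 -> exists2 v : 'rV_n, v != 0 & v *m z = 0.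
Proof.
move=> n0 zk; have : kermx z != 0.
  rewrite kermx_eq0 /row_free neq_ltn.
  have := @nilp_exp_rank _ _ z k 1 zk; rewrite expr1 => rz.
  by apply/orP; left; lia.
by case/rowV0Pn => v /sub_kermxP vz v0; exists v.
Qed.

(** For an alternating form any kernel vector will do. For a symmetric form and nonzero [z], a
    vector in the image of the last nonzero power of [z] is isotropic, since moving that power
    across the form doubles the exponent. *)
Lemma isotropic_kernel (K : closedFieldType) n (J z : 'M[K]_n) d :
  2%:R != 0 :> K -> J \in unitmx -> J^T = (-1) ^+ d *: J -> nilp J z -> (1 < n)%N ->
  exists v : 'rV_n, [/\ v != 0, v *m z = 0 & form J v v = 0].
Proof.
move=> two0 uJ JT [lz [k zk]] n1; case: (boolP (odd d)) => od.
  have [v v0 vz] := nilp_kernel (ltnW n1) zk; exists v; split=> //.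
  by apply: alternating_form => //; rewrite JT -signr_odd od expr1 scaleN1r.
have [z0|z0] := eqVneq z 0.
  have JT' : J^T = J by rewrite JT -signr_odd (negbTE od) expr0 scale1r.
  have [|e [f [ee ff ef]]] := symmetric_hyperbolic two0 JT'; first by rewrite mxrank_unit.
  exists e; split; rewrite ?z0 ?mulmx0 //; apply: contra_eq_neq ef => ->.
  by rewrite /form !mul0mx mxE eq_sym oner_neq0.
have ex : exists k, z ^+ k == 0 by exists k; apply/eqP.
have [m /eqP zm minm] := ex_minnP ex.
case: m zm minm => [|[|m]] zm minm.
- by case/eqP: z0; rewrite -(mulmx1 z) (_ : 1%:M = 0) ?mulmx0 // -zm expr0.
- by case/eqP: z0; rewrite -(expr1 z).
have : z ^+ m.+1 != 0 by apply/negP => /minm; rewrite ltnn.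
case/rowV0Pn => v /submxP[u ->] v0; exists (u *m z ^+ m.+1); split=> //.
  by rewrite -mulmxA mulmxE -exprSr zm mulmx0.
rewrite /form trmx_mul -!mulmxA (mulmxA J) lie_exp_tr // -scalemxAl -!scalemxAr.
rewrite !mulmxA -(mulmxA u) mulmxE -exprD (_ : m.+1 + m.+1 = m.+2 + m)%N; last by lia.
by rewrite exprD zm mul0r mulmx0 !mul0mx scaler0 mxE.
Qed.

(** Each step splits off a hyperbolic plane and preserves n - d. The base cases are [d = 0], a
    symmetric form in dimension 1 or 2, where [z] vanishes, and [d = 1], the symplectic plane. *)
Lemma pencil_exists (K : closedFieldType) d : 2%:R != 0 :> K ->
  forall n (J z : 'M[K]_n), J \in unitmx -> J^T = (-1) ^+ d *: J -> nilp J z ->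
  (n = d.+1 \/ n = d.+2 /\ ~~ odd d) -> pencil J d z.
Proof.
move=> two0; have [m] := ubnP d; elim: m d => // m IH [|[|d]] dm n J z uJ JT nz nE.
- have JT' : J^T = J by rewrite JT expr0 scale1r.
  have z0 : z = 0.
    have [lz [k zk]] := nz.
    have rz : (\rank z <= 1)%N.
      by have := @nilp_exp_rank _ _ z k 1 zk; rewrite expr1; lia.
    suff zJ : z *m J = 0 by rewrite -(mulmxK uJ z) zJ mul0mx.
    apply/eqP/negPn/negP => /(alternating_rank two0) H.
    have : (1 < \rank (z *m J))%N.
      apply: H; rewrite trmx_mul JT'; apply/eqP; rewrite -addr_eq0 addrC.
      by rewrite lz.
    by rewrite ltnNge (leq_trans (mxrankM_maxl _ _)).
  (* The zero direction is allowed because [0 ^+ 0] is the identity, nonzero in positive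
     dimension. *)
  exists 0; split.
  - by rewrite /lie mul0mx trmx0 mulmx0 addr0.
  - rewrite expr0; apply/eqP/matrixP.
    by case: nE => [|[+ _]] => nE; subst n => /(_ ord0 ord0)/eqP; rewrite !mxE oner_eq0.
  by move=> t; rewrite expr1 z0 scaler0 addr0.
- have n2 : n = 2 by case: nE => [->|[]].
  subst n; have [lz [k /nilp_exp_dim z2]] := nz.
  have [z0|z0] := eqVneq z 0; last first.
    exists z; rewrite expr1; split=> // t.
    by rewrite -[z in z + _]scale1r -scalerDl exprZn z2 scaler0.
  pose v : 'rV[K]_2 := delta_mx 0 0.
  have JT' : J^T = - J by rewrite JT expr1 scaleN1r.
  have vJv : v *m J *m v^T = 0.
    by rewrite formE alternating_form // raddf0.
  (* The nilpotent part of a transvection; its square vanishes because [v] is isotropic. *)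
  exists (J *m v^T *m v); split.
  - by rewrite /lie !trmx_mul trmxK JT' !mulmxA mulmxN addrC addNr.
  - rewrite expr1; apply/eqP => /(congr1 (mulmx (invmx J))).
    rewrite mulmx0 !mulmxA mulVmx // mul1mx => /matrixP/(_ 0 0).
    by rewrite /v trmx_delta mul_delta_mx !mxE /= => /eqP; rewrite oner_eq0.
  move=> t; rewrite z0 add0r exprZn (_ : (J *m v^T *m v) ^+ 2 = 0) ?scaler0 //.
  by rewrite expr2 -mulmxE !mulmxA -2!(mulmxA (J *m v^T)) vJv mulmx0 mul0mx.
pose n' := (n - 2)%N.
have nE' : n = (1 + (n' + 1))%N by rewrite /n'; lia.
move: n' nE' => n' nE'; subst n.
have n1 : (1 < 1 + (n' + 1))%N by lia.
have JT' : J^T = (-1) ^+ d *: J by rewrite JT -signr_odd /= negbK signr_odd.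
have ee : (-1) ^+ d * (-1) ^+ d = 1 :> K by rewrite -expr2 sqrr_sign.
have [v [v0 vz vv]] := isotropic_kernel two0 uJ JT' nz n1.
have [E [J' [uE EJE uJ' J'T Ev]]] := hyperbolic_splitting two0 uJ JT' ee v0 vv.
apply: (pencil_conj uE); rewrite EJE; apply: pencil_split => //.
- move=> Y nY; apply: IH => //; first by lia.
  case: nE => [nE|[nE /=]]; first by left; lia.
  by rewrite negbK => od; right; split=> //; lia.
- case: nz => lz [k zk]; split; first by rewrite -EJE; apply: lie_conj.
  by exists k; rewrite conj_exp // zk mulmx0 mul0mx.
by rewrite !mulmxA Ev vz mul0mx.
Qed.

(** * The regular orbit *)

Lemma gram_entry (K : fieldType) m p n (P : 'M[K]_(m, n)) (S : 'M[K]_n) (Q : 'M[K]_(p, n)) i j :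
  (P *m S *m Q^T) i j = form S (row i P) (row j Q).
Proof.
by rewrite /form -row_mul mxE [RHS]mxE; apply: eq_bigr => k _; rewrite !mxE.
Qed.

(** These values determine the Gram matrix of the chain [e *m x ^+ i], since powers of [x] cross the
    form with a sign. They are normalised by descending induction on [i], from the nonzero symmetric
    form [x ^+ d *m J]. *)
Lemma regular_vector (K : closedFieldType) n (J x : 'M[K]_n) d :
  2%:R != 0 :> K -> J \in unitmx -> J^T = (-1) ^+ d *: J -> lie J x ->
  x ^+ d != 0 -> x ^+ d.+1 = 0 ->
  exists e : 'rV_n, forall i, form (x ^+ i *m J) e e = (i == d)%:R.
Proof.
move=> two0 uJ JT lx xd xd1.
have fl i j u v : form (x ^+ i *m J) (u *m x ^+ j) v = form (x ^+ (i + j) *m J) u v.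
  by rewrite /form addnC exprD -mulmxE !mulmxA.
have fr i j u v : form (x ^+ i *m J) u (v *m x ^+ j) = (-1) ^+ j * form (x ^+ (i + j) *m J) u v.
  rewrite -formZm /form trmx_mul !mulmxA -(mulmxA _ J) lie_exp_tr // exprD -mulmxE.
  by rewrite -!scalemxAr -!scalemxAl !mulmxA.
have tr i : (x ^+ i *m J)^T = (-1) ^+ (d + i) *: (x ^+ i *m J).
  by rewrite trmx_mul JT -scalemxAl lie_exp_tr // scalerA exprD.
have hi i : (d < i)%N -> forall u v, form (x ^+ i *m J) u v = 0.
  move=> di u v; rewrite (_ : x ^+ i = 0) ?mul0mx ?/form ?mulmx0 ?mul0mx ?mxE //.
  by rewrite -(subnK di) exprD xd1 mulr0.
suff H m : (m <= d)%N -> exists e : 'rV_n, forall i, (d - m <= i)%N ->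
    form (x ^+ i *m J) e e = (i == d)%:R.
  have [e He] := H d (leqnn d); exists e => i; apply: He; lia.
elim: m => [_|m IH md].
  have [||e He] := @symmetric_unit_vector _ _ (x ^+ d *m J) two0.
  - by rewrite tr -signr_odd addnn odd_double expr0 scale1r.
  - by apply: contraNneq xd => xJ; rewrite -(mulmxK uJ (x ^+ d)) xJ mul0mx.
  exists e => i; rewrite subn0 leq_eqVlt => /orP[/eqP<-|di]; first by rewrite eqxx He.
  by rewrite hi // gtn_eqF.
have [e He] := IH (ltnW md).
set k := (d - m.+1)%N; have dk : d = (k + m.+1)%N by rewrite /k; lia.
case: (boolP (odd (d + k))) => odk.
  (* For this parity [x ^+ k *m J] is alternating and the value is already 0. *)
  exists e => i; rewrite leq_eqVlt => /orP[/eqP <-|ki]; last by apply: He; lia.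
  rewrite (_ : (k == d) = false); last by lia.
  by apply: alternating_form => //; rewrite tr -signr_odd odk expr1 scaleN1r.
(* Adding c e x^(d-k) to e changes form (x^k J) e e by 2c and leaves the values
   for i > k unchanged. *)
have oj : odd m.+1 = false by lia.
have sj : (-1) ^+ m.+1 = 1 :> K by rewrite -signr_odd oj.
pose c := - (2%:R^-1 * form (x ^+ k *m J) e e).
exists (e + c *: (e *m x ^+ m.+1)) => i ki.
have -> : form (x ^+ i *m J) (e + c *: (e *m x ^+ m.+1)) (e + c *: (e *m x ^+ m.+1)) =
   form (x ^+ i *m J) e e + 2%:R * c * form (x ^+ (i + m.+1) *m J) e e
   + c ^+ 2 * form (x ^+ (i + m.+1 + m.+1) *m J) e e.
  by rewrite !formB !fl !fr !sj; ring.
rewrite (hi (i + m.+1 + m.+1)%N) ?mulr0 ?addr0; last by lia.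
move: ki; rewrite leq_eqVlt => /orP[/eqP <-|ki].
  rewrite -/k -dk (He d) ?leq_subr // eqxx.
  rewrite (_ : (k == d) = false); last by lia.
  by rewrite /c /= mulr1 mulr0n; field.
by rewrite (hi (i + m.+1)%N) ?mulr0 ?addr0 ?He //; lia.
Qed.

(** Gram matrix of the chain [e *m x ^+ i] of [regular_vector]; the sign comes from moving [x ^+ j]
    across the form. *)
Definition anti_mx (K : fieldType) d : 'M[K]_d.+1 :=
  \matrix_(i, j) ((-1) ^+ j * (i + j == d)%N%:R).

Lemma anti_mx_unit (K : fieldType) d : anti_mx K d \in unitmx.
Proof.
have [] // := @mulmx1_unit _ _ (anti_mx K d) (anti_mx K d)^T.
apply/matrixP => i j; rewrite !mxE (bigD1 (rev_ord i)) //= big1 => [|k ki].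
  rewrite !mxE /= addr0 (_ : (i + (d.+1 - i.+1) == d)%N); last by have := ltn_ord i; lia.
  rewrite mulr1 mulrA -expr2 sqrr_sign mul1r -(inj_eq val_inj).
  congr (_%:R); rewrite /=; have := ltn_ord i; have := ltn_ord j; lia.
rewrite !mxE (_ : (i + k == d)%N = false) ?mulr0 ?mul0r //.
by apply: contra_neqF ki => /eqP H; apply: val_inj => /=; lia.
Qed.

Lemma regular_chain (K : closedFieldType) n (J x : 'M[K]_n) d :
  2%:R != 0 :> K -> J \in unitmx -> J^T = (-1) ^+ d *: J -> lie J x ->
  x ^+ d != 0 -> x ^+ d.+1 = 0 ->
  exists C : 'M_(d.+1, n), C *m J *m C^T = anti_mx K d /\
     C *m x = jordan_mx K d.+1 [:: d.+1] *m C.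
Proof.
move=> two0 uJ JT lx xd xd1.
have [e He] := regular_vector two0 uJ JT lx xd xd1.
pose C : 'M_(d.+1, n) := \matrix_(i < d.+1) (e *m x ^+ i).
have rC (i : 'I_d.+1) : row i C = e *m x ^+ i by rewrite rowK.
exists C; split.
  apply/matrixP => i j; rewrite gram_entry !rC mxE.
  rewrite /form trmx_mul !mulmxA -(mulmxA _ J) lie_exp_tr // -!scalemxAr -scalemxAl mxE.
  by congr (_ * _); rewrite -He /form exprD -mulmxE !mulmxA.
apply/row_matrixP => i; rewrite row_mul rC -mulmxA mulmxE -exprSr.
rewrite row_mul.
have [id|id] := ltnP i.+1 d.+1.
  rewrite (_ : row i _ = delta_mx 0 (Ordinal id)) -?rowE ?rC //.
  apply/rowP => j; rewrite !mxE /= inE add0n -(inj_eq val_inj) /=.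
  by rewrite (_ : (j != d.+1 :> nat)) ?andbT //; have := ltn_ord j; lia.
rewrite (_ : row i _ = 0).
  have -> : i.+1 = d.+1 by have := ltn_ord i; lia.
  by rewrite xd1 mulmx0 mul0mx.
apply/rowP => j; rewrite !mxE (_ : (_ == _) = false) //.
by have := ltn_ord j; lia.
Qed.

(** A simultaneous normal form of the form and the element: prescribing [G] as well as [S] makes the
    change of basis between two such elements an isometry. *)
Definition framed (K : fieldType) n (J x S G : 'M[K]_n) :=
  exists E, [/\ E \in unitmx, E *m J *m E^T = G & E *m x = S *m E].

Lemma framed_orbit (K : fieldType) n (J x y S G : 'M[K]_n) :
  framed J x S G -> framed J y S G -> orbit J x y.
Proof.
move=> [E [uE EG Ex]] [F [uF FG Fy]]; exists (invmx F *m E).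
  rewrite /isom trmx_mul !mulmxA -2!(mulmxA (invmx F)) EG -FG !mulmxA mulVmx // mul1mx.
  by rewrite -mulmxA -trmx_mul mulVmx // trmx1 mulmx1.
rewrite invmxM ?unitmx_inv // invmxK !mulmxA -(mulmxA _ E x) Ex.
by rewrite !mulmxA mulmxK // -!mulmxA -Fy mulKmx.
Qed.

(** The Jordan type of regular elements is [d+1] in the first case and [d+1,1] in the second, that
    of symmetric forms in even dimension. *)
Definition regular_dim n d := n = d.+1 \/ n = d.+2 /\ ~~ odd d.

(** [S] and [G] are chosen before [J] and [x], so that two different forms can be compared as well,
    as in [four_two_exists]. *)
Lemma regular_framed (K : closedFieldType) n d :
  2%:R != 0 :> K -> regular_dim n d ->
  exists S G : 'M[K]_n, forall J x : 'M[K]_n,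
    J \in unitmx -> J^T = (-1) ^+ d *: J -> lie J x ->
    x ^+ d != 0 -> x ^+ d.+1 = 0 -> framed J x S G.
Proof.
move=> two0 [nE|[nE od]].
  subst n; exists (jordan_mx K d.+1 [:: d.+1]), (anti_mx K d) => J x uJ JT lx xd xd1.
  have [C [CJ Cx]] := regular_chain two0 uJ JT lx xd xd1.
  exists C; split=> //; have := anti_mx_unit K d.
  by rewrite -CJ !unitmx_mul => /andP[/andP[]].
have {}nE : n = (d.+1 + 1)%N by lia.
subst n; exists (block_mx (jordan_mx K d.+1 [:: d.+1]) 0 0 0), (block_mx (anti_mx K d) 0 0 1%:M).
move=> J x uJ JT lx xd xd1.
have [C [CJ Cx]] := regular_chain two0 uJ JT lx xd xd1.
have uA := anti_mx_unit K d.
have JT' : J^T = J by rewrite JT -signr_odd (negbTE od) expr0 scale1r.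
(* The chain spans a hyperplane, whose orthogonal complement is the line of [f]; scaled to value 1,
   [f] completes the basis. *)
have [f f0 fC] : exists2 f : 'rV_(d.+1 + 1), f != 0 & f *m (J *m C^T) = 0.
  have : kermx (J *m C^T) != 0.
    rewrite kermx_eq0 /row_free neq_ltn.
    by apply/orP; left; rewrite (leq_ltn_trans (rank_leq_col _)) // addn1.
  by case/rowV0Pn => f /sub_kermxP; exists f.
rewrite mulmxA in fC.
have Cf : C *m J *m f^T = 0.
  by apply: trmx_inj; rewrite !trmx_mul trmxK JT' mulmxA fC trmx0.
have unitE (g : 'rV_(d.+1 + 1)) : g != 0 -> C *m J *m g^T = 0 -> g *m J *m C^T = 0 ->
    col_mx C g \in unitmx.
  move=> g0 Cg gC; rewrite -row_free_unit; apply: inj_row_free => u.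
  rewrite -[u]hsubmxK; move: (lsubmx u) (rsubmx u) => a b; rewrite mul_row_col => H.
  have a0 : a = 0.
    have := congr1 (mulmx^~ (J *m C^T)) H.
    rewrite mul0mx mulmxDl -!mulmxA (mulmxA g) gC mulmx0 addr0 (mulmxA C) CJ.
    by move/(canRL (mulmxK uA)); rewrite mul0mx.
  move: H; rewrite a0 mul0mx add0r [b]mx11_scalar mul_scalar_mx => /eqP.
  by rewrite scaler_eq0 (negbTE g0) orbF => /eqP->; rewrite raddf0 row_mx0.
have ff : form J f f != 0.
  apply: (contraNneq _ f0) => ff; have uE := unitE f f0 Cf fC.
  have : f *m J *m (col_mx C f)^T = 0.
    by rewrite tr_col_mx mul_mx_row fC formE ff raddf0 row_mx0.
  rewrite -unitmx_tr in uE; move/(canRL (mulmxK uE)); rewrite mul0mx.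
  by move/(canRL (mulmxK uJ)); rewrite mul0mx => ->.
have [s s2] := closed_sqrt (form J f f)^-1.
have s0 : s != 0 by rewrite -sqrf_eq0 s2 invr_eq0.
pose g := s *: f.
have g0 : g != 0 by rewrite scaler_eq0 negb_or s0.
have Cg : C *m J *m g^T = 0 by rewrite linearZ -scalemxAr Cf scaler0.
have gC : g *m J *m C^T = 0 by rewrite -!scalemxAl fC scaler0.
have gg : form J g g = 1 by rewrite formZl formZr mulrA -expr2 s2 mulVf.
have uE := unitE g g0 Cg gC.
(* [g *m x] is orthogonal to the chain, which [x] preserves, and to [g], because [x *m J] is
   alternating. *)
have gx : g *m x = 0.
  have xJ : x *m J = - (J *m x^T) by apply/eqP; rewrite -addr_eq0; apply/eqP.
  have : g *m x *m J *m (col_mx C g)^T = 0.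
    rewrite tr_col_mx mul_mx_row.
    rewrite -(mulmxA g) [X in row_mx _ X]formE alternating_form //; last first.
      by rewrite trmx_mul JT' xJ opprK.
    rewrite raddf0 xJ mulmxN mulNmx mulmxA -mulmxA -trmx_mul Cx trmx_mul mulmxA gC.
    by rewrite mul0mx oppr0 row_mx0.
  have uE' := uE; rewrite -unitmx_tr in uE'; move/(canRL (mulmxK uE')); rewrite mul0mx.
  by move/(canRL (mulmxK uJ)); rewrite mul0mx.
exists (col_mx C g); split=> //.
  by rewrite tr_col_mx mul_col_mx mul_col_row CJ Cg gC formE gg.
by rewrite mul_col_mx Cx gx mul_block_col !mul0mx !addr0.
Qed.

(** * Closure of the regular orbit *)

Lemma mxeval_line (K : fieldType) n (p : {mpoly K[n * n]}) (A B : 'M[K]_n) :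
  exists q : {poly K}, forall t, q.[t] = mxeval p (A + t *: B).
Proof.
have [q qE] := meval_horner (fun k => (mxvec A 0 k)%:P + mxvec B 0 k *: 'X) p.
exists q => t; rewrite qE; apply: meval_eq => k.
by rewrite !hornerE linearD linearZ !mxE mulrC.
Qed.

Lemma nilp_expS0 (K : closedFieldType) n d (J z : 'M[K]_n) :
  2%:R != 0 :> K -> regular_dim n d -> J \in unitmx -> J^T = (-1) ^+ d *: J ->
  nilp J z -> z ^+ d.+1 = 0.
Proof.
move=> two0 dn uJ JT nz; have [w [_ _ /(_ 0)]] := pencil_exists two0 uJ JT nz dn.
by rewrite scale0r addr0.
Qed.

Lemma regular_exists (K : closedFieldType) n d (J : 'M[K]_n) :
  2%:R != 0 :> K -> regular_dim n d -> J \in unitmx -> J^T = (-1) ^+ d *: J ->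
  exists2 x, nilp J x & x ^+ d != 0.
Proof.
move=> two0 dn uJ JT.
have n0 : nilp J (0 : 'M_n).
  split; first by rewrite /lie mul0mx trmx0 mulmx0 addr0.
  by exists 1%N; rewrite expr1.
have [w [lw wd /(_ 1)]] := pencil_exists two0 uJ JT n0 dn.
by rewrite add0r scale1r => w0; exists w => //; split=> //; exists d.+1.
Qed.

Lemma regular_orbit (K : closedFieldType) n d (J x y : 'M[K]_n) :
  2%:R != 0 :> K -> regular_dim n d -> J \in unitmx -> J^T = (-1) ^+ d *: J ->
  nilp J x -> x ^+ d != 0 -> nilp J y -> y ^+ d != 0 -> orbit J x y.
Proof.
move=> two0 dn uJ JT nx xd ny yd; have [S [G SG]] := regular_framed two0 dn.
have x0 := nilp_expS0 two0 dn uJ JT nx; have y0 := nilp_expS0 two0 dn uJ JT ny.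
case: nx ny => lx _ [ly _].
exact: framed_orbit (SG J x uJ JT lx xd x0) (SG J y uJ JT ly yd y0).
Qed.

Lemma regular_closure (K : closedFieldType) n d (J x z : 'M[K]_n) :
  2%:R != 0 :> K -> regular_dim n d -> J \in unitmx -> J^T = (-1) ^+ d *: J ->
  nilp J x -> x ^+ d != 0 -> nilp J z -> zclosure (orbit J x) z.
Proof.
move=> two0 dn uJ JT nx xd nz p p0.
have [w [lw wd pw]] := pencil_exists two0 uJ JT nz dn.
have /matrix0Pn[i [j wij]] := wd.
have genE y : mxeval ((generic_mx K n ^+ d) i j) y = (y ^+ d) i j.
  by have /matrixP/(_ i j) := mxevalX y d; rewrite mxE.
have [q qE] := mxeval_line p z w.
have [r rE] := mxeval_line ((generic_mx K n ^+ d) i j) z w.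
(* The polynomial r is nonzero since its reversal r' has constant term
   (w^d) i j. *)
have [r' r'E] := mxeval_line ((generic_mx K n ^+ d) i j) w z.
have r'0 : r' != 0.
  by apply: contraNneq wij => r'0; rewrite -genE -[w]addr0 -(scale0r z) -r'E r'0 horner0.
have r0 : r != 0.
  have r'X0 : r' * 'X != 0 by rewrite mulf_neq0 ?polyX_eq0.
  have [s] := poly_neq0_nonroot r'X0.
  rewrite hornerM hornerX mulf_eq0 negb_or => /andP[rs s0].
  apply: contraNneq rs => r0; rewrite r'E genE.
  have -> : w + s *: z = s *: (z + s^-1 *: w).
    by rewrite scalerDr scalerA mulfV // scale1r addrC.
  by rewrite scalemx_exp mxE -genE -rE r0 horner0 mulr0.
suff q0 : q = 0 by rewrite -[z]addr0 -(scale0r w) -qE q0 horner0.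
apply: (eq_poly_off_roots r0) => t; rewrite rE genE => rt.
rewrite qE horner0; apply: p0; apply: (regular_orbit two0 dn uJ JT nx xd).
  split; last by exists d.+1.
  have [lz _] := nz; move: lz lw; rewrite /lie => lz lw.
  rewrite linearD linearZ /= mulmxDl mulmxDr addrACA lz add0r -scalemxAl -scalemxAr.
  by rewrite -scalerDr lw scaler0.
by apply: contraNneq rt => ->; rewrite mxE.
Qed.

Lemma regular_dom_le (K : closedFieldType) n d (J x z : 'M[K]_n) :
  2%:R != 0 :> K -> regular_dim n d -> J \in unitmx -> J^T = (-1) ^+ d *: J ->
  nilp J x -> x ^+ d != 0 -> nilp J z -> dom_le J z x.
Proof.
move=> two0 dn uJ JT nx xd nz y zy p p0; apply: zy => t zt.
exact: (regular_closure two0 dn uJ JT nx xd (orbit_nilp uJ nz zt)).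
Qed.

(** The equation [x ^+ d = 0] is closed and conjugation invariant, so it would pass from the largest
    orbit to the regular elements in its closure. *)
Lemma largest_regular (K : closedFieldType) n d (J x : 'M[K]_n) :
  2%:R != 0 :> K -> regular_dim n d -> J \in unitmx -> J^T = (-1) ^+ d *: J ->
  largest J x -> x ^+ d != 0.
Proof.
move=> two0 dn uJ JT [nx xmax]; have [w nw wd] := regular_exists two0 dn uJ JT.
apply: contraNneq wd => xd; apply/eqP; rewrite -mxevalX.
have wx : zclosure (orbit J x) w.
  by apply: (xmax w nw) => p; apply; apply: orbit_refl.
apply: zclosure_mx wx _ => y [g gJ ->].
by rewrite mxevalX conj_exp ?(isom_unit uJ) // xd mulmx0 mul0mx.
Qed.

(** * Small symplectic spaces *)

Lemma rank1_mul (K : fieldType) m n (a b : 'cV[K]_m) (e h : 'rV[K]_n) (M : 'M[K]_(n, m)) :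
  a *m e *m M *m (b *m h) = (e *m M *m b) 0 0 *: (a *m h).
Proof.
rewrite !mulmxA -2!(mulmxA a) [X in a *m X]mx11_scalar.
by rewrite mul_mx_scalar -scalemxAl.
Qed.

(** The kernel contains a hyperbolic plane; [P] and [Q] are the rank one projections onto its lines
    through [e] and [f]. *)
Lemma kernel_pair (K : fieldType) n (J y : 'M[K]_n) (e f : 'rV[K]_n) :
  2%:R != 0 :> K -> J^T = - J -> lie J y -> e *m y = 0 -> f *m y = 0 ->
  form J e f = 1 -> ~ pair_free J y.
Proof.
move=> two0 JT ly ey fy ef fr.
have alt (u : 'rV_n) : form J u u = 0 by apply: alternating_form.
have mul (u v w x : 'rV_n) :
    (J *m u^T *m v) *m (J *m w^T *m x) = form J v w *: (J *m u^T *m x).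
  by rewrite -[J *m u^T *m v]mulmx1 rank1_mul mulmx1 /form mulmxA.
pose P := J *m f^T *m e; pose Q := J^T *m e^T *m f.
have P0 : P = 0.
  apply: (fr P Q); rewrite /P /Q.
    rewrite JT !mulNmx; split.
    - by rewrite mul ef scale1r.
    - by rewrite mulmxN mul alt scale0r oppr0.
    - by rewrite mulNmx mul alt scale0r oppr0.
    by rewrite linearN /= !trmx_mul !trmxK JT !mulmxN opprK !mulmxA.
  rewrite -mulmxA ey mulmx0 !mulmxA.
  suff -> : y *m J *m f^T = 0 by rewrite mul0mx.
  apply/eqP; rewrite -oppr_eq0 -mulNmx -(lie_J_tr ly).
  by rewrite -mulmxA -trmx_mul fy trmx0 mulmx0.
have eP : e *m P = e by rewrite /P !mulmxA formE ef mul1mx.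
by have /eqP := ef; rewrite -eP P0 mulmx0 /form !mul0mx mxE eq_sym oner_eq0.
Qed.

(* The projections are those onto the spans of e, e y and of f, f y. *)
Lemma square_zero_pair (K : fieldType) n (J y : 'M[K]_n) (e f : 'rV[K]_n) :
  2%:R != 0 :> K -> J^T = - J -> lie J y -> y *m y = 0 ->
  form (y *m J) e e = 0 -> form (y *m J) f f = 0 -> form (y *m J) e f = 1 ->
  form J e f = 0 -> ~ pair_free J y.
Proof.
move=> two0 JT ly yy ee ff ef1 ef0 fr.
have alt (u : 'rV_n) : form J u u = 0 by apply: alternating_form.
have mul (u v w x : 'rV_n) :
    (J *m u^T *m v) *m (J *m w^T *m x) = form J v w *: (J *m u^T *m x).
  by rewrite -[J *m u^T *m v]mulmx1 rank1_mul mulmx1 /form mulmxA.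
have muly (u v w x : 'rV_n) :
    (J *m u^T *m v) *m y *m (J *m w^T *m x) = form (y *m J) v w *: (J *m u^T *m x).
  by rewrite rank1_mul /form !mulmxA.
(* [A] sends u to (u, f) e, and [C] sends u to (u, e) f; [y *m A + A *m y] fixes both [e] and
   [e *m y]. *)
pose A := J *m f^T *m e; pose C := J *m e^T *m f.
have AA : A *m A = 0 by rewrite /A mul ef0 scale0r.
have AC : A *m C = 0 by rewrite /A /C mul alt scale0r.
have CA : C *m A = 0 by rewrite /A /C mul alt scale0r.
have AyA : A *m y *m A = A by rewrite /A muly ef1 scale1r.
have AyC : A *m y *m C = 0 by rewrite /A /C muly ee scale0r.
have CyA : C *m y *m A = 0 by rewrite /A /C muly ff scale0r.
have AJ : A *m J = - (J *m C^T).
  by rewrite /A /C !trmx_mul trmxK JT ?mulNmx !mulmxN !mulmxA opprK.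
have P0 : y *m A + A *m y = 0.
  move: A C AA AC CA AyA AyC CyA AJ => A C AA AC CA AyA AyC CyA AJ.
  have prod (X Y : 'M_n) : X *m Y = 0 ->
      (y *m X + X *m y) *m (y *m Y + Y *m y) = y *m (X *m y *m Y) + X *m y *m Y *m y.
    move=> XY; rewrite mulmxDl !mulmxDr !mulmxA -(mulmxA _ y y) yy mulmx0 mul0mx add0r.
    by rewrite -(mulmxA y X Y) XY mulmx0 mul0mx addr0.
  apply: (fr _ (y *m C + C *m y)).
    split.
    - by rewrite prod ?AyA.
    - by rewrite prod ?AyC ?mulmx0 ?mul0mx ?addr0.
    - by rewrite prod ?CyA ?mulmx0 ?mul0mx ?addr0.
    rewrite linearD /= !trmx_mul mulmxDl mulmxDr -!(mulmxA _ _ J) AJ.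
    have yJ : y *m J = - (J *m y^T) by rewrite (lie_J_tr ly) opprK.
    rewrite yJ !mulmxN !mulmxA AJ yJ !mulNmx !opprK; exact: addrC.
  by rewrite mulmxDl mulmxDr !mulmxA yy -(mulmxA A) yy mulmx0 mul0mx add0r addr0.
have ePy : e *m (y *m A + A *m y) = e.
  have e0 : e *m J *m f^T = 0 by rewrite formE ef0 raddf0.
  have e1 : e *m y *m J *m f^T = 1%:M by rewrite -(mulmxA e y) formE ef1.
  by rewrite mulmxDr /A !mulmxA e0 e1 !mul0mx mul1mx addr0.
by have /eqP := ef1; rewrite -ePy P0 mulmx0 /form !mul0mx mxE eq_sym oner_eq0.
Qed.

(** Unless the kernel contains a hyperbolic plane it is totally isotropic, of dimension at most n /
    2. This is impossible for n = 2, and for n = 4 it forces type [2,2], where the space is a sum of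
    two [y]-stable isotropic planes. *)
Lemma small_alternating_pair (K : closedFieldType) n (J y : 'M[K]_n) :
  2%:R != 0 :> K -> J \in unitmx -> J^T = - J -> nilp J y ->
  (n = 2 \/ n = 4)%N -> y ^+ n.-1 = 0 -> ~ pair_free J y.
Proof.
move=> two0 uJ JT [ly _] n24 yn.
have [K0|K0] := eqVneq (kermx y *m J *m (kermx y)^T) 0; last first.
  have /matrix0Pn[i [j]] := K0; rewrite gram_entry => ij.
  have ker k : row k (kermx y) *m y = 0 by rewrite -row_mul mulmx_ker row0.
  apply: (@kernel_pair _ _ J y (row i (kermx y))
    ((form J (row i (kermx y)) (row j (kermx y)))^-1 *: row j (kermx y))) => //.
    by rewrite -scalemxAl ker scaler0.
  by rewrite formZr mulVf.
have ry : (n <= (\rank y).*2)%N.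
  have : (kermx y <= kermx (J *m (kermx y)^T))%MS.
    by apply/sub_kermxP; rewrite mulmxA.
  move/mxrankS; rewrite !mxrank_ker.
  have -> : \rank (J *m (kermx y)^T) = (n - \rank y)%N.
    rewrite -mxrank_tr trmx_mul trmxK mxrankMfree ?mxrank_ker //.
    by rewrite row_free_unit unitmx_tr.
  have := rank_leq_row y; lia.
case: n24 => nE; subst n.
  by move: ry; rewrite -(expr1 y) yn mxrank0.
(* Otherwise the alternating form [y ^+ 2 *m J] has rank at least 2, while [y ^+ 2] maps into the
   kernel, of dimension at most 2. Then [y] and [y ^+ 2] have the same row space, against
   [y ^+ 3 = 0]. *)
have y2 : y ^+ 2 = 0.
  apply/eqP/negPn/negP => y20.
  have r2 : (1 < \rank (y ^+ 2))%N.
    have : (1 < \rank (y ^+ 2 *m J))%N.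
      apply: alternating_rank => //.
        by rewrite trmx_mul JT mulNmx lie_exp_tr // sqrrN expr1n scale1r.
      by apply: contraNneq y20 => yJ; rewrite -(mulmxK uJ (y ^+ 2)) yJ mul0mx.
    by move/leq_trans; apply; apply: mxrankM_maxl.
  have : (y ^+ 2 <= kermx y)%MS by apply/sub_kermxP; rewrite mulmxE -exprSr.
  move/mxrankS; rewrite mxrank_ker => r4.
  have y2y : (y ^+ 2 <= y)%MS by rewrite expr2 submxMl.
  have /submxP[M yM] : (y <= y ^+ 2)%MS.
    by rewrite -(geq_leqif (mxrank_leqif_sup y2y)); lia.
  case/eqP: y20; rewrite expr2 {1}yM -mulmxE -mulmxA mulmxE -exprSr yn mulr0.
  by [].
have [||e [f [ee ff ef]]] := @symmetric_hyperbolic _ _ (y *m J) two0.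
- by rewrite trmx_mul JT mulNmx (lie_J_tr ly) opprK.
- by rewrite mxrankMfree ?row_free_unit //; lia.
have yy : y *m y = 0 by rewrite mulmxE -expr2.
have fl (u v : 'rV_4) : form (y *m J) (u *m y) v = 0.
  by rewrite /form -!mulmxA (mulmxA y y) yy mul0mx !mulmx0 mxE.
have fr (u v : 'rV_4) : form (y *m J) u (v *m y) = 0.
  rewrite /form trmx_mul -(mulmxA u) -!mulmxA (mulmxA J) (lie_J_tr ly).
  by rewrite mulNmx -!mulmxA mulmxN (mulmxA y y) yy mul0mx oppr0 mulmx0 mxE.
have fJ (u v : 'rV_4) : form J u (v *m y) = - form (y *m J) u v.
  by rewrite /form trmx_mul mulmxA -(mulmxA u) (lie_J_tr ly) mulmxN mulNmx mxE.
(* The multiple of [f *m y] makes [f] orthogonal to [e] and, as [y *m y = 0], leaves the values of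
   [form (y *m J)] unchanged. *)
apply: (@square_zero_pair _ _ J y e (f + form J e f *: (f *m y))) => //.
- by rewrite !formB ff !fr fl !mulr0 !addr0.
- by rewrite formDr formZr ef fr mulr0 addr0.
by rewrite formDr formZr fJ ef mulrN1 subrr.
Qed.

(** * Distinguished elements *)

(** Each coordinate subgroup of a torus in the stabilizer is a cocharacter centralizing [y], hence
    trivial; these subgroups generate the torus, which is therefore trivial. *)
Lemma pair_free_distinguished (K : closedFieldType) n (J y : 'M[K]_n) :
  J \in unitmx -> nilp J y -> pair_free J y -> distinguished J y.
Proof.
move=> uJ ny fy; split=> // T [TJ [_ [r [phi [Tphi phiM [P [k phiE]] _]]]]] Ty.
pose Gm (a : 'I_r -> K) := forall i, a i != 0.
have phiT a : Gm a -> T (phi a) by move=> a0; apply/Tphi; exists a.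
have phiJ a : Gm a -> isom J (phi a) by move/phiT/TJ.
have phiy a : Gm a -> phi a *m y = y *m phi a.
  move=> a0; have [gJ] := Ty _ (phiT a a0); move/(congr1 (mulmx^~ (phi a))).
  by rewrite mulmxKV ?(isom_unit uJ gJ).
(* The arguments of [phi] are functions; the Laurent formula shows that only their values matter. *)
have phi_ext a b : Gm a -> a =1 b -> phi a = phi b.
  move=> a0 ab; have b0 : Gm b by move=> i; rewrite -ab.
  rewrite !phiE // (eq_bigr b) //; congr (_ *: _).
  by apply/matrixP => i j; rewrite !mxE; apply: meval_eq.
pose coord i (s : K) := fun j : 'I_r => if j == i then s else 1.
have coord0 i s : s != 0 -> Gm (coord i s).
  by move=> s0 j; rewrite /coord; case: ifP; rewrite ?oner_neq0.
have phi1 i s : s != 0 -> phi (coord i s) = 1%:M.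
  have [Q QE] : exists Q : 'M[{poly K}]_n, forall s,
      map_mx (fun p => p.[s]) Q = map_mx (meval (coord i s)) P.
    have /fin_all_exists[f fE] : forall u, exists f : 'I_n -> {poly K},
        forall v s, (f v).[s] = (P u v).@[coord i s].
      move=> u; suff /fin_all_exists[f fE] : forall v, exists q : {poly K},
          forall s, q.[s] = (P u v).@[coord i s] by exists f.
      move=> v; have [q qE] := meval_horner (fun j : 'I_r => if j == i then 'X else 1) (P u v).
      exists q => t; rewrite qE; apply: meval_eq => j; rewrite /coord.
      by case: ifP; rewrite hornerE.
    by exists (\matrix_(u, v) f u v) => t; apply/matrixP => u v; rewrite !mxE fE.
  have coc : cocharacter J (fun s => phi (coord i s)).
    split.
    - by move=> a a0; apply/phiJ/coord0.
    - move=> a b a0 b0; rewrite -phiM; try exact: coord0.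
      apply: phi_ext; first by apply: coord0; rewrite mulf_neq0.
      by move=> j; rewrite /coord; case: ifP; rewrite ?mulr1.
    exists Q, k => a a0; rewrite QE phiE; last exact: coord0.
    congr (_ ^- _ *: _); rewrite (bigD1 i) //= /coord eqxx big1 ?mulr1 // => j ji.
    by rewrite (negbTE ji).
  case: (cocharacter_centralizing uJ coc (y := y)) s => [a a0|//|].
    by apply/phiy/coord0.
  by case=> [A [B [AB /eqP A0 /(fy _ _ AB)]]].
suff phi_trivial a : Gm a -> phi a = 1%:M.
  move=> g /Tphi[a a0 ->]; split; first exact: phiJ.
  by move=> h _; rewrite phi_trivial // mul1mx mulmx1.
(* Tuples truncated after [m] coordinates, to reach [a] one coordinate at a time. *)
move=> a0; pose tr m := fun j : 'I_r => if (j < m)%N then a j else 1.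
have tr0 m : Gm (tr m) by move=> j; rewrite /tr; case: ifP; rewrite ?oner_neq0.
suff H m : phi (tr m) = 1%:M.
  by rewrite -(H r); apply: phi_ext => // j; rewrite /tr ltn_ord.
elim: m => [|m IH].
  have u1 := isom_unit uJ (phiJ _ (tr0 0%N)).
  apply: (can_inj (mulKmx u1)); rewrite mulmx1 -phiM; [|exact: tr0..].
  apply: phi_ext; last by move=> j; rewrite /tr /= mulr1.
  by move=> j; rewrite mulf_neq0 ?tr0.
have [mr|rm] := ltnP m r; last first.
  rewrite -IH; apply: phi_ext => // j; rewrite /tr.
  by rewrite !(leq_trans (ltn_ord j)) // ltnW.
rewrite -[RHS]mulmx1 -{1}IH -(phi1 (Ordinal mr) (a (Ordinal mr))) // -phiM;
  [|exact: tr0|exact: coord0].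
  apply: phi_ext => // j; rewrite /tr /coord -(inj_eq val_inj) /= ltnS leq_eqVlt.
  case: eqVneq => [jm|jm] /=; last by rewrite mulr1.
  by rewrite jm ltnn mul1r; congr (a _); apply: val_inj.
Qed.

(** The ranks of [A], [A *m y], ..., [A *m y ^+ k] decrease strictly and the last one is
    positive. *)
Lemma commuting_nilp_rank (K : fieldType) n (A y : 'M[K]_n) N k :
  y ^+ N = 0 -> A *m y = y *m A -> A *m y ^+ k != 0 -> (k < \rank A)%N.
Proof.
move=> yN; elim: k A => [|k IH] A Ay; first by rewrite expr0 mulmx1 lt0n mxrank_eq0.
rewrite exprS -mulmxE mulmxA => Ak.
have A0 : A != 0 by apply: contraNneq Ak => ->; rewrite !mul0mx.
apply: leq_ltn_trans (IH (A *m y) _ Ak) (nilp_rank_lt yN _ A0).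
  by rewrite mulmxA -Ay.
by rewrite Ay submxMl.
Qed.

(* Since y^3 J is symmetric of rank one, P y^3 = 0, hence y^3 lives on the image
   of R, which thus has dimension at least 4; so P has rank at most one. *)
Lemma four_two_pair_free (K : closedFieldType) (J y : 'M[K]_6) :
  J \in unitmx -> J^T = - J -> nilp J y -> y ^+ 3 != 0 ->
  (\rank (y ^+ 3) <= 1)%N -> (kermx y <= y)%MS -> pair_free J y.
Proof.
move=> uJ JT [ly [N yN]] y30 ry3 kery P Q PQp Py.
have JT1 : J^T = (-1) ^+ 1 *: J by rewrite JT expr1 scaleN1r.
have [QQ _ _ QJ] := adjoint_pair_sym uJ JT1 PQp.
have [PP PQ QP PJ] := PQp.
have Qy : Q *m y = y *m Q by apply: adjoint_pair_commute PJ Py.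
have comX (A : 'M_6) i : A *m y = y *m A -> A *m y ^+ i = y ^+ i *m A.
  move=> Ay; elim: i => [|i IH]; first by rewrite expr0 mulmx1 mul1mx.
  by rewrite exprS -mulmxE mulmxA Ay -mulmxA IH mulmxA.
have Py3 : P *m y ^+ 3 = 0.
  have [S SE] : exists S, S = y ^+ 3 *m J by eexists.
  have ST : S^T = S.
    by rewrite SE trmx_mul JT mulNmx lie_exp_tr // -signr_odd expr1 scaleN1r opprK.
  have PS : P *m S = S *m Q^T by rewrite SE (mulmxA P) comX // -(mulmxA _ P) PJ !mulmxA.
  have QS : Q *m S = S *m P^T by rewrite SE (mulmxA Q) comX // -(mulmxA _ Q) QJ !mulmxA.
  have [PS0|PS0] := eqVneq (P *m S) 0.
    by rewrite -(mulmxK uJ (P *m y ^+ 3)) -(mulmxA P) -SE PS0 mul0mx.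
  (* As [S] has rank one, it would be a left multiple of [P *m S]; then [(P *m S)^T = S *m P^T]
     would be a left multiple of [P *m Q *m S], which is 0. *)
  have PSS : (P *m S <= S)%MS := submxMl _ _.
  have /submxP[M SM] : (S <= P *m S)%MS.
    rewrite -(geq_leqif (mxrank_leqif_sup PSS)).
    have : (\rank S <= 1)%N by rewrite SE (leq_trans (mxrankM_maxl _ _)).
    by move/leq_trans; apply; rewrite lt0n mxrank_eq0.
  case/eqP: PS0; rewrite -[P *m S]trmxK trmx_mul ST SM -!mulmxA -QS (mulmxA P) PQ.
  by rewrite mul0mx mulmx0 trmx0.
have Qy3 : Q *m y ^+ 3 = 0.
  apply: trmx_inj; apply: (can_inj (mulKmx uJ)); rewrite trmx0 mulmx0.
  rewrite trmx_mul mulmxA lie_exp_tr // -scalemxAl -(mulmxA _ J) -PJ mulmxA -comX //.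
  by rewrite Py3 mul0mx scaler0.
pose R := 1%:M - P - Q.
have RP : R *m P = 0 by rewrite !mulmxBl PP QP mul1mx subrr subr0.
have RQ : R *m Q = 0 by rewrite !mulmxBl QQ PQ mul1mx subr0 subrr.
have rR : (3 < \rank R)%N.
  apply: (commuting_nilp_rank yN).
    by rewrite !mulmxBl !mulmxBr mul1mx mulmx1 Py Qy.
  by rewrite !mulmxBl mul1mx Py3 Qy3 !subr0.
(* Otherwise [P] and [Q] have rank at least 2 each, and their independent images lie in the kernel
   of [R], of dimension at most 2. *)
have Py0 : P *m y = 0.
  apply/eqP/negPn/negP => Py0.
  have rP : (1 < \rank P)%N by apply: (commuting_nilp_rank yN Py); rewrite expr1.
  have rQ : \rank Q = \rank P.
    have := congr1 (fun A : 'M_6 => \rank A) PJ.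
    rewrite mxrankMfree ?row_free_unit // => ->.
    by rewrite -[RHS]mxrank_tr trmx_mul trmxK mxrankMfree ?row_free_unit ?unitmx_tr.
  have PQ0 : (P :&: Q = 0)%MS.
    apply/eqP; rewrite -submx0; apply/row_subP => i; set w := row i _.
    have /submxP[a wP] : (w <= P)%MS by rewrite (submx_trans (row_sub _ _)) ?capmxSl.
    have /submxP[b wQ] : (w <= Q)%MS by rewrite (submx_trans (row_sub _ _)) ?capmxSr.
    have -> : w = w *m P by rewrite wP -mulmxA PP.
    by rewrite wQ -mulmxA QP mulmx0 sub0mx.
  have : ((P + Q)%MS <= kermx R)%MS.
    have PR : P *m R = 0 by rewrite !mulmxBr PP PQ mulmx1 subrr subr0.
    have QR : Q *m R = 0 by rewrite !mulmxBr QQ QP mulmx1 subr0 subrr.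
    by rewrite addsmx_sub; apply/andP; split; apply/sub_kermxP.
  move/mxrankS; rewrite mxrank_disjoint_sum // mxrank_ker rQ; lia.
(* No Jordan block has size 1: the kernel lies in the image, so [P] factors through [y], and
   [P = P *m P] becomes a left multiple of [P *m y]. *)
have /submxP[M PM] : (P <= y)%MS.
  by apply: submx_trans kery; apply/sub_kermxP.
by rewrite -PP {1}PM -mulmxA -Py Py0 mulmx0.
Qed.

(** * Partitions *)

Lemma similar_conj (K : fieldType) n (x y : 'M[K]_n) :
  similar_in unitmx x y -> exists2 g, g \in unitmx & x = g *m y *m invmx g.
Proof.
case=> p up /(similarP up) pxy; exists (invmx p); first by rewrite unitmx_inv.
by rewrite invmxK -mulmxA -pxy mulKmx.
Qed.

Lemma jordan_single_exp (K : fieldType) d : jordan_mx K d.+1 [:: d.+1] ^+ d != 0.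
Proof.
set S := jordan_mx _ _ _.
suff H k (kd : (k < d.+1)%N) : delta_mx 0 ord0 *m S ^+ k = delta_mx 0 (Ordinal kd) :> 'rV_d.+1.
  apply/eqP => Sd; have := H d (ltnSn d); rewrite Sd mulmx0 => /matrixP/(_ 0 ord_max).
  by rewrite !mxE /= -(inj_eq val_inj) /= eqxx => /esym/eqP; rewrite oner_eq0.
elim: k kd => [|k IH] kd.
  by rewrite expr0 mulmx1; congr delta_mx; apply: val_inj.
rewrite exprSr -mulmxE mulmxA (IH (ltnW kd)) -rowE.
apply/rowP => j; rewrite !mxE /= inE add0n -(inj_eq val_inj) /=.
by rewrite (_ : (j != d.+1 :> nat)) ?andbT //; have := ltn_ord j; lia.
Qed.

Lemma partition_single_exp (K : fieldType) d (x : 'M[K]_d.+1) :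
  has_partition x [:: d.+1] -> x ^+ d != 0.
Proof.
case=> _ _ _ /similar_conj[g ug ->]; rewrite conj_exp // conj_eq0 //.
exact: jordan_single_exp.
Qed.

Lemma partition_single (K : closedFieldType) d (J x : 'M[K]_d.+1) :
  2%:R != 0 :> K -> J \in unitmx -> J^T = (-1) ^+ d *: J -> nilp J x ->
  has_partition x [:: d.+1] <-> x ^+ d != 0.
Proof.
move=> two0 uJ JT nx; split; first exact: partition_single_exp.
move=> xd; have xd1 := nilp_expS0 two0 (or_introl erefl) uJ JT nx.
have [lx _] := nx; have [C [CJ Cx]] := regular_chain two0 uJ JT lx xd xd1.
split=> //=; first by rewrite addn0.
have uC : C \in unitmx.
  by have := anti_mx_unit K d; rewrite -CJ !unitmx_mul => /andP[/andP[]].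
by exists C => //; apply/similarP.
Qed.

(** * An explicit symplectic element of Jordan type [4,2] *)

Ltac ord6 i := case: i => [[|[|[|[|[|[|?]]]]]] //= ?].

(** Orthogonal sum of the alternating forms [anti_mx] of sizes 4 and 2, one for each Jordan block;
    the second block has indices 4 and 5, whence the sum 9. *)
Definition model_form (K : fieldType) : 'M[K]_6 :=
  \matrix_(i, j) ((-1) ^+ j *
    (((i + j == 3) && (i < 4)) || ((i + j == 9) && (3 < i) && (3 < j)))%N%:R).

Lemma model_form_unit (K : fieldType) : model_form K \in unitmx.
Proof.
have [] // := @mulmx1_unit _ _ (model_form K) (model_form K)^T.
apply/matrixP => i j; rewrite !mxE !big_ord_recl big_ord0 !mxE.
ord6 i; ord6 j; rewrite /bump /=; ring.
Qed.

Lemma model_form_tr (K : fieldType) : (model_form K)^T = - model_form K.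
Proof. by apply/matrixP => i j; rewrite !mxE; ord6 i; ord6 j; ring. Qed.

Lemma model_lie (K : fieldType) : lie (model_form K) (jordan_mx K 6 [:: 4; 2]%N).
Proof.
apply/matrixP => i j; rewrite !mxE !big_ord_recl !big_ord0 !mxE.
by ord6 i; ord6 j; rewrite /bump /=; ring.
Qed.

Lemma model_exp3 (K : fieldType) :
  jordan_mx K 6 [:: 4; 2]%N ^+ 3 = delta_mx 0 (@Ordinal 6 3 isT).
Proof.
rewrite !exprS expr0 mulr1 -!mulmxE.
apply/matrixP => i j; rewrite !mxE !big_ord_recl !big_ord0 !mxE.
rewrite !big_ord_recl !big_ord0 !mxE.
by ord6 i; ord6 j; rewrite /bump /=; ring.
Qed.

Lemma model_ker (K : fieldType) :
  (kermx (jordan_mx K 6 [:: 4; 2]%N) <= jordan_mx K 6 [:: 4; 2]%N)%MS.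
Proof.
set y := jordan_mx K 6 [:: 4; 2]%N.
(* [1%:M - y^T *m y] projects onto the first vectors of the two blocks, and [y *m y^T] fixes these,
   both blocks being longer than 1. *)
have yZ : 1%:M - y^T *m y = y *m y^T *m (1%:M - y^T *m y).
  pose D : 'M[K]_6 := \matrix_(i, j) ((i == j) && ((i == 0%N :> nat) || (i == 4%N :> nat)))%:R.
  have -> : 1%:M - y^T *m y = D.
    apply/matrixP => i j; rewrite !mxE !big_ord_recl !big_ord0 !mxE.
    by ord6 i; ord6 j; rewrite /bump /=; ring.
  rewrite -mulmxA.
  apply/matrixP => i j; rewrite !mxE !big_ord_recl !big_ord0 !mxE.
  rewrite !big_ord_recl !big_ord0 !mxE.
  by ord6 i; ord6 j; rewrite /bump /=; ring.
have : kermx y *m (1%:M - y^T *m y) = 0 by rewrite yZ !mulmxA mulmx_ker !mul0mx.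
rewrite mulmxBr mulmx1 => /eqP; rewrite subr_eq0 mulmxA => /eqP ->.
exact: submxMl.
Qed.

Lemma four_two_facts (K : fieldType) (y : 'M[K]_6) : has_partition y [:: 4; 2]%N ->
  [/\ y ^+ 3 != 0, (\rank (y ^+ 3) <= 1)%N, (kermx y <= y)%MS & y ^+ 5 = 0].
Proof.
case=> _ _ _ /similar_conj[g ug yE].
have y3E : y ^+ 3 = g *m delta_mx 0 (@Ordinal 6 3 isT) *m invmx g.
  by rewrite yE conj_exp // model_exp3.
have y30 : y ^+ 3 != 0.
  rewrite y3E conj_eq0 //; apply/eqP => /matrixP/(_ 0 (@Ordinal 6 3 isT)).
  by rewrite !mxE !eqxx => /eqP; rewrite oner_eq0.
have ry3 : (\rank (y ^+ 3) <= 1)%N.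
  rewrite y3E (leq_trans (mxrankM_maxl _ _)) // (leq_trans (mxrankM_maxr _ _)) //.
  by rewrite mxrank_delta.
have y6 : y ^+ 6 = 0.
  rewrite (exprD _ 3 3) -mulmxE y3E !mulmxA mulmxKV // -(mulmxA g).
  by rewrite mul_delta_mx_cond /= mulr0n mulmx0 mul0mx.
split=> //.
  have : (kermx y *m g <= jordan_mx K 6 [:: 4; 2]%N)%MS.
    apply: submx_trans (model_ker K); apply/sub_kermxP.
    apply: (can_inj (mulmxK (_ : invmx g \in unitmx))); first by rewrite unitmx_inv.
    by rewrite mul0mx -2!(mulmxA (kermx y)) -yE mulmx_ker.
  case/submxP=> M kM; apply/submxP; exists (M *m invmx g).
  by rewrite {2}yE !mulmxA mulmxKV // -kM mulmxK.
apply/eqP/negPn/negP => y5; have := @commuting_nilp_rank _ _ (y ^+ 3) y 6 2 y6.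
rewrite !mulmxE -exprS -exprSr -exprD => /(_ erefl y5); lia.
Qed.

(** Regular elements for [J] and for [model_form] have the same frame, so the two forms are
    isometric and [h] transports the model. *)
Lemma four_two_exists (K : closedFieldType) (J : 'M[K]_6) :
  2%:R != 0 :> K -> J \in unitmx -> J^T = - J ->
  exists2 y, nilp J y & has_partition y [:: 4; 2]%N.
Proof.
move=> two0 uJ JT.
have JT5 : J^T = (-1) ^+ 5 *: J by rewrite -signr_odd expr1 scaleN1r.
have uM := model_form_unit K.
have MT : (model_form K)^T = (-1) ^+ 5 *: model_form K.
  by rewrite -signr_odd expr1 scaleN1r model_form_tr.
have dim : regular_dim 6 5 by left.
have [x nx x5] := regular_exists two0 dim uJ JT5.
have [z nz z5] := regular_exists two0 dim uM MT.
have [S [G SG]] := regular_framed two0 dim.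
have [E [uE EG _]] := SG J x uJ JT5 (proj1 nx) x5 (nilp_expS0 two0 dim uJ JT5 nx).
have [F [uF FG _]] := SG _ z uM MT (proj1 nz) z5 (nilp_expS0 two0 dim uM MT nz).
pose h := invmx E *m F; have uh : h \in unitmx by rewrite unitmx_mul unitmx_inv uE.
have hJ : h *m model_form K *m h^T = J.
  rewrite /h trmx_mul !mulmxA -2!(mulmxA (invmx E)) FG -EG !mulmxA mulVmx // mul1mx.
  by rewrite -mulmxA -trmx_mul mulVmx // trmx1 mulmx1.
clearbody h; set y0 := jordan_mx K 6 [:: 4; 2]%N.
have py : has_partition (h *m y0 *m invmx h) [:: 4; 2]%N.
  have uV : invmx h \in unitmx by rewrite unitmx_inv.
  by split=> //; exists (invmx h) => //; apply/(similarP uV); rewrite !mulmxA mulVmx // mul1mx.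
exists (h *m y0 *m invmx h) => //; split; first by rewrite -hJ; apply/lie_conj/model_lie.
by have [_ _ _ y5] := four_two_facts py; exists 5%N.
Qed.

(** * The symplectic and orthogonal cases *)

Lemma pair_free_not_accessible (K : closedFieldType) n d (J x y : 'M[K]_n) :
  2%:R != 0 :> K -> regular_dim n d -> J \in unitmx -> J^T = (-1) ^+ d *: J ->
  nilp J x -> x ^+ d != 0 -> nilp J y -> pair_free J y -> ~ orbit J x y ->
  dom_lt J y x /\ ~ accessible J x y.
Proof.
move=> two0 dn uJ JT nx xd ny fy oxy; split.
  by split=> //; apply: (regular_dom_le two0 dn uJ JT nx xd ny).
by move/(accessible_pair_free uJ fy).
Qed.

Lemma orbit_exp (K : fieldType) n (J x y : 'M[K]_n) k :
  J \in unitmx -> orbit J x y -> x ^+ k != 0 -> y ^+ k != 0.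
Proof. by move=> uJ [g gJ ->] xk; have ug := isom_unit uJ gJ; rewrite conj_exp // conj_eq0. Qed.

Lemma orders_differ_of (K : fieldType) n (J x y : 'M[K]_n) :
  nilp J x -> nilp J y -> dom_lt J y x /\ ~ accessible J x y -> orders_differ J.
Proof. by move=> nx ny [[yx _] nacc] H; apply: nacc; apply/H. Qed.

Lemma symplectic_case (K : closedFieldType) N (J : 'M[K]_N) :
  2%:R != 0 :> K -> (0 < N)%N -> ~~ odd N -> nondeg_alternating J ->
  [/\ exists2 x, nilp J x & has_partition x [:: N],
      forall x y, nilp J x -> has_partition x [:: N] ->
        distinguished J y -> ~ has_partition y [:: N] ->
        dom_lt J y x /\ ~ accessible J x y,
      (exists2 y, distinguished J y & ~ has_partition y [:: N]) -> orders_differ J &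
      (exists2 y, distinguished J y & ~ has_partition y [:: N]) -> (6 <= N)%N].
Proof.
case: N J => // d J two0 _ oN [uJ /alternating_tr JT].
have od : odd d by move: oN; rewrite /= negbK.
have JTd : J^T = (-1) ^+ d *: J by rewrite -signr_odd od expr1 scaleN1r.
have dim : regular_dim d.+1 d by left.
have part := partition_single two0 uJ JTd.
have [x0 nx0 x0d] := regular_exists two0 dim uJ JTd.
have main x y : nilp J x -> has_partition x [:: d.+1] -> distinguished J y ->
    ~ has_partition y [:: d.+1] -> dom_lt J y x /\ ~ accessible J x y.
  move=> nx px dy npy; have [ny _] := dy; have xd := (part x nx).1 px.
  apply: (pair_free_not_accessible two0 dim uJ JTd nx xd ny).
    exact: (distinguished_pair_free two0 uJ JTd dy).
  by move/(orbit_exp uJ)/(_ xd)/(part y ny).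
have px0 := (part x0 nx0).2 x0d.
split=> //; first by exists x0.
  case=> y dy npy; apply: (orders_differ_of nx0 dy.1).
  exact: main.
case=> y dy npy; have [ny _] := dy.
have fy := distinguished_pair_free two0 uJ JTd dy.
have yd : y ^+ d = 0 by apply/eqP/negPn/negP => /(part y ny).
rewrite leqNgt; apply/negP => d6.
by apply: (small_alternating_pair two0 uJ JT ny _ yd fy); move: od; lia.
Qed.

Lemma four_two_case (K : closedFieldType) (J : 'M[K]_6) :
  2%:R != 0 :> K -> nondeg_alternating J ->
  (exists y, [/\ distinguished J y, has_partition y [:: 4; 2]%N &
                 ~ has_partition y [:: 6]%N]) /\
  (forall x y, nilp J x -> has_partition x [:: 6]%N ->
     nilp J y -> has_partition y [:: 4; 2]%N ->
     dom_lt J y x /\ ~ accessible J x y).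
Proof.
move=> two0 [uJ /alternating_tr JT].
have JT5 : J^T = (-1) ^+ 5 *: J by rewrite -signr_odd expr1 scaleN1r.
have free y : nilp J y -> has_partition y [:: 4; 2]%N -> pair_free J y.
  by move=> ny /four_two_facts[? ? ? _]; apply: four_two_pair_free.
split=> [|x y nx px ny py].
  have [y ny py] := four_two_exists two0 uJ JT; exists y; split=> //.
    by apply: pair_free_distinguished => //; apply: free.
  by move/partition_single_exp; have [_ _ _ ->] := four_two_facts py; rewrite eqxx.
have x5 := partition_single_exp px.
apply: (pair_free_not_accessible two0 (or_introl erefl) uJ JT5 nx x5 ny (free y ny py)).
by move/(orbit_exp uJ)/(_ x5); have [_ _ _ ->] := four_two_facts py; rewrite eqxx.
Qed.

Lemma orthogonal_case (K : closedFieldType) n (J : 'M[K]_n) :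
  2%:R != 0 :> K -> (0 < n)%N -> nondeg_symmetric J ->
  [/\ exists x, largest J x,
      forall x y, largest J x -> distinguished J y -> ~ orbit J x y ->
        dom_lt J y x /\ ~ accessible J x y &
      forall x, largest J x ->
        (exists2 y, distinguished J y & ~ orbit J x y) -> orders_differ J].
Proof.
move=> two0 n0 [uJ JT].
have [d dim ed] : exists2 d, regular_dim n d & ~~ odd d.
  by exists (n.-1 - ~~ odd n)%N; rewrite ?/regular_dim; lia.
have JTd : J^T = (-1) ^+ d *: J by rewrite -signr_odd (negbTE ed) expr0 scale1r.
have [x0 nx0 x0d] := regular_exists two0 dim uJ JTd.
have main x y : largest J x -> distinguished J y -> ~ orbit J x y ->
    dom_lt J y x /\ ~ accessible J x y.
  move=> lx dy oxy; have xd := largest_regular two0 dim uJ JTd lx.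
  apply: (pair_free_not_accessible two0 dim uJ JTd lx.1 xd dy.1 _ oxy).
  exact: (distinguished_pair_free two0 uJ JTd dy).
split=> //.
  exists x0; split=> // z nz; exact: (regular_dom_le two0 dim uJ JTd nx0 x0d nz).
move=> x lx [y dy oxy]; exact: (orders_differ_of lx.1 dy.1 (main x y lx dy oxy)).
Qed.

Theorem mainTheorem4 (K : closedFieldType) (charK : 2%N \notin [pchar K]) :
  (* (a) *)
  (forall (n : nat) (J : 'M[K]_(2 * n)), (0 < n)%N -> nondeg_alternating J ->
     [/\ exists2 x, nilp J x & has_partition x [:: (2 * n)%N],
         forall x y, nilp J x -> has_partition x [:: (2 * n)%N] ->
           distinguished J y -> ~ has_partition y [:: (2 * n)%N] ->
           dom_lt J y x /\ ~ accessible J x y,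
         (exists2 y, distinguished J y & ~ has_partition y [:: (2 * n)%N]) ->
           orders_differ J &
         (exists2 y, distinguished J y & ~ has_partition y [:: (2 * n)%N]) ->
           (6 <= 2 * n)%N])
  /\
  (forall J : 'M[K]_6, nondeg_alternating J ->
     (exists y, [/\ distinguished J y, has_partition y [:: 4; 2]%N &
                    ~ has_partition y [:: 6]%N]) /\
     (forall x y, nilp J x -> has_partition x [:: 6]%N ->
        nilp J y -> has_partition y [:: 4; 2]%N ->
        dom_lt J y x /\ ~ accessible J x y))
  /\
  (* (b) *)
  (forall (n : nat) (J : 'M[K]_n), (0 < n)%N -> nondeg_symmetric J ->
     [/\ exists x, largest J x,
         forall x y, largest J x -> distinguished J y -> ~ orbit J x y ->
           dom_lt J y x /\ ~ accessible J x y &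
         forall x, largest J x ->
           (exists2 y, distinguished J y & ~ orbit J x y) -> orders_differ J]).
Proof.
have two0 := two_neq0 charK; split=> [n J n0 altJ|].
  by apply: symplectic_case; rewrite ?muln_gt0 // mul2n odd_double.
split=> [J|n J n0]; first exact: four_two_case.
exact: orthogonal_case.
Qed.
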